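(* Let $\{X^u\}_{u\in\mathbb Z^n}$ be an $n$-parameter filtration of a cell complex $X$. For each grade $u\in\mathbb Z^n$ and each $q\ge0$, $$\mu_q(u)\ \ge\ \xi_0^q(u)+\xi_1^{q-1}(u)-\sum_{i=1}^{n-1}\xi_{i+1}^{q-i}(u)+R,$$ where $$R=\sum_{r=2}^{n-1}\left(\sum_{i=1}^{r-1}\dim\operatorname{im}d^r_{i,q-i}+\sum_{i=r+1}^{n-1}\dim\operatorname{im}d^r_{i,q-i}+\sum_{i=1}^{n-1}\dim\operatorname{im}d^r_{i+r,q-i-r+1}\right)$$ is a non-negative integer. Here $d^r_{p,q}:E^r_{p,q}\to E^r_{p-r,q+r-1}$ are the differentials of the Mayer-Vietoris spectral sequence of the collection $\{X^{u-e_j}\}_{j\in[n]}$.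
   Context: Fix a field $\mathbb F$; all homology is over $\mathbb F$ and $\dim$ of a vector space means $\dim_{\mathbb F}$. Cell complexes. A cell complex is a finite graded set $X=\bigsqcup_{q\ge 0}X_q$ (elements of $X_q$ are called $q$-cells) with an incidence function $\kappa:X\times X\to\mathbb F$ such that $\kappa(\tau,\sigma)\ne0$ implies $\dim\tau=\dim\sigma+1$, and $\sum_{\rho}\kappa(\tau,\rho)\kappa(\rho,\sigma)=0$ for all $\tau,\sigma$. Its chain complex $C_*(X)$ has $C_q(X)$ with basis $X_q$ and $\partial_q(\tau)=\sum_{\sigma\in X_{q-1}}\kappa(\tau,\sigma)\sigma$. The partial order $\le$ on $X$ is generated by $\sigma<\tau$ whenever $\kappa(\tau,\sigma)\neq0$. A subcomplex $A\subseteq X$ is a subset generating a chain subcomplex $C_*(A)\subseteq C_*(X)$. $H_q(X)$ is the homology of $C_*(X)$, and $H_q(X,A)$ that of $C_*(X)/C_*(A)$. Filtrations. For $n\ge1$, $[n]=\{1,\dots,n\}$, $e_1,\dots,e_n$ is the standard basis of $\mathbb Z^n$, $e_\sigma=\sum_{j\in\sigma}e_j$ for $\sigma\subseteq[n]$, and $\preceq$ is the coordinatewise order on $\mathbb Z^n$. An $n$-parameter filtration of $X$ is a family $\{X^u\}_{u\in\mathbb Z^n}$ of subcomplexes with $X^u\subseteq X^v$ for $u\preceq v$. All filtrations are assumed one-critical, i.e. $X^u=\{\sigma\in X\mid f(\sigma)\preceq u\}$ for some order-preserving $f:(X,\le)\to(\mathbb Z^n,\preceq)$ (so that $\bigcap_{j\in\sigma}X^{u-e_j}=X^{u-e_\sigma}$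 for $\emptyset\ne\sigma\subseteq[n]$), and bounded, i.e. $X^u\neq\emptyset$ implies $0\preceq u$, and $X^u=X$ for $u$ sufficiently large. Homological Morse numbers: $\mu_q(u):=\dim H_q(X^u,\bigcup_{j=1}^nX^{u-e_j})$. Koszul complex and Betti tables. $V_q=H_q(\mathcal X)$ is the persistence module with $V_q^u=H_q(X^u)$ and maps $\iota_q^{u,v}:H_q(X^u)\to H_q(X^v)$ induced by inclusions. Its Koszul complex at grade $u$ has $\mathbb K_i(x_1,\dots,x_n;V_q)(u)=\bigoplus_{\sigma\subseteq[n],|\sigma|=i}H_q(X^{u-e_\sigma})$ for $0\le i\le n$ and $0$ otherwise; its differential $d_i$ restricted to the summand of $\sigma=\{j_1<\dots<j_i\}$ is $\sum_{r=0}^{i-1}(-1)^r\iota_q^{u-e_\sigma,\,u-e_{\sigma\setminus\{j_{i-r}\}}}$. The Betti table is $\xi_i^q(u):=\dim H_i(\mathbb K_*(x_1,\dots,x_n;V_q)(u))$ (so $\xi^q_i(u)=0$ unless $0\le i\le n$ and $q\ge0$). Mayer-Vietoris spectral sequence of $\{X^{u-e_j}\}_{j\in[n]}$. Consider the double complex $C_{p,q}=\bigoplus_{\sigma\subseteq[n],|\sigma|=p+1}C_q(\bigcap_{j\in\sigma}X^{u-e_j})$ for $p,q\ge0$ and $0$ otherwise. The horizontal differential $\delta_{p,q}:C_{p,q}\to C_{p-1,q}$ ($p\ge1$), restricted to the summand of $\sigma=\{j_1<\dots<j_{p+1}\}$, is $\sum_{i=0}^p(-1)^i$ times the inclusion into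 the summand of $\sigma\setminus\{j_{p+1-i}\}$; the vertical differential $\partial_{p,q}:C_{p,q}\to C_{p,q-1}$ is $(-1)^p$ times the one induced by $C_*(X)$. Let $T_*$ be the total complex, $T_k=\bigoplus_{p+q=k}C_{p,q}$ with differential $\sum(\delta_{p,q}+\partial_{p,q})$. The spectral sequence $\{E^r_{p,q},d^r_{p,q}\}$ is the one associated with the filtration $F^{\mathrm I}_pT_k=\bigoplus_{i\le p}C_{i,k-i}$; so $E^0_{p,q}=C_{p,q}$ with $d^0=\partial$, and $E^1_{p,q}$ is vertical homology with $d^1$ induced by $\delta$. *)

(* Defs.v *)
From HB Require Import structures.
From mathcomp Require Import all_boot all_order all_algebra.

Set Implicit Arguments.
Unset Strict Implicit.
Unset Printing Implicit Defensive.

Import Order.TTheory GRing.Theory Num.Theory.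
Local Open Scope ring_scope.

(* MathComp has no quotient of a vector space by a subspace.  For B <= Z, the
   quotient Z / B is realised on the complement Z :\: B of B in Z; lemmas
   [cls_eq0] and [cls_rep] say that [cls] restricted to Z is a surjection with
   kernel B.  If B is not contained in Z, this is Z / (Z :&: B). *)
Section Quotient.
Variables (F : fieldType) (V : vectType F).
Implicit Types Z B : {vspace V}.

Definition quot Z B : vectType F := subvs_of (Z :\: B)%VS.

Definition cls Z B : 'Hom(V, quot Z B) :=
  linfun (fun v : V => vsproj (Z :\: B)%VS (addv_pi1 Z B v)).

Definition rep Z B : quot Z B -> V := vsval.

Lemma clsE Z B v : cls Z B v = vsproj (Z :\: B)%VS (addv_pi1 Z B v).
Proof.
have lin : linear (fun v : V => vsproj (Z :\: B)%VS (addv_pi1 Z B v)).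
  by move=> a x y; rewrite !linearP.
pose m := GRing.isLinear.Build _ _ _ _ _ lin.
pose f : {linear V -> quot Z B} := HB.pack (fun v : V => _ : quot Z B) m.
exact: (lfunE f v).
Qed.

Lemma rep_mem Z B (x : quot Z B) : rep x \in Z.
Proof. exact: (subvP (diffvSl Z B)) (subvsP x). Qed.

Lemma cls_rep Z B (x : quot Z B) : cls Z B (rep x) = x.
Proof.
by rewrite clsE /addv_pi1 daddv_pi_id ?capv_diff ?subvsP //; apply: vsvalK.
Qed.

Lemma cls_eq0 Z B v : v \in Z -> (cls Z B v == 0) = (v \in B).
Proof.
move=> vZ; have vs : v \in (Z + B)%VS by apply: subvP vZ; apply: addvSl.
have vE := addv_pi1_pi2 vs; rewrite clsE -(inj_eq val_inj) /= vsprojK ?memv_pi //.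
apply/eqP/idP => [v0 | vB].
  by rewrite -vE v0 add0r /addv_pi2 memv_pi.
have : addv_pi1 Z B v \in ((Z :\: B) :&: B)%VS.
  rewrite memv_cap memv_pi /= (_ : _ v = v - addv_pi2 Z B v).
    by rewrite memvB // memv_pi.
  by rewrite -[X in _ = X - _]vE addrK.
by rewrite capv_diff memv0 => /eqP.
Qed.

End Quotient.

(* The map Z / B -> Z' / B' induced by f, for f Z <= Z' and f B <= B'. *)
Definition quot_map (F : fieldType) (V V' : vectType F)
    (Z B : {vspace V}) (Z' B' : {vspace V'}) (f : 'Hom(V, V')) :
    'Hom(quot Z B, quot Z' B') :=
  linfun (fun x : quot Z B => cls Z' B' (f (rep x))).

Lemma quot_map_cls (F : fieldType) (V V' : vectType F)
    (Z B : {vspace V}) (Z' B' : {vspace V'}) (f : 'Hom(V, V')) (v : V) :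
  (f @: Z <= Z')%VS -> (f @: B <= B')%VS -> v \in Z ->
  quot_map Z B Z' B' f (cls Z B v) = cls Z' B' (f v).
Proof.
move=> fZ fB vZ.
have lin : linear (fun x : quot Z B => cls Z' B' (f (rep x))).
  by move=> a x y; rewrite /rep !linearP.
pose m := GRing.isLinear.Build _ _ _ _ _ lin.
pose g : {linear quot Z B -> quot Z' B'} := HB.pack (fun x : quot Z B => _) m.
rewrite (lfunE g (cls Z B v)) /g /=; apply/eqP; rewrite -subr_eq0 -!linearB /=.
have dZ : rep (cls Z B v) - v \in Z by rewrite memvB // rep_mem.
rewrite cls_eq0; last by apply: subvP fZ _ _; apply: memv_img.
apply: subvP fB _ _; apply: memv_img.
by rewrite -(cls_eq0 _ dZ) linearB /= cls_rep subrr.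
Qed.

(* External direct sum of a finite family of vector spaces. *)
Definition dsum (F : fieldType) (I : finType) (T : I -> vectType F) :=
  {dffun forall i, T i}.

Import VectorInternalTheory.

Section DirectSum.
Variables (F : fieldType) (I : finType) (T : I -> vectType F).
Local Notation D := (dsum T).

HB.instance Definition _ := Choice.copy D {dffun forall i, T i}.

Definition mkdsum (f : forall i, T i) : D := @finfun I T f.

Lemma mkdsumE f i : mkdsum f i = f i. Proof. exact: ffunE. Qed.

Lemma dsumP (f g : D) : (forall i, f i = g i) -> f = g.
Proof. by move=> fg; apply/ffunP. Qed.

Definition dsum_add (f g : D) : D := mkdsum (fun i => f i + g i).
Definition dsum_opp (f : D) : D := mkdsum (fun i => - f i).
Definition dsum_zero : D := mkdsum (fun i => 0).
Definition dsum_scale (a : F) (f : D) : D := mkdsum (fun i => a *: f i).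

Fact dsum_addA : associative dsum_add.
Proof. by move=> f g h; apply: dsumP => i; rewrite !mkdsumE addrA. Qed.
Fact dsum_addC : commutative dsum_add.
Proof. by move=> f g; apply: dsumP => i; rewrite !mkdsumE addrC. Qed.
Fact dsum_add0 : left_id dsum_zero dsum_add.
Proof. by move=> f; apply: dsumP => i; rewrite !mkdsumE add0r. Qed.
Fact dsum_addN : left_inverse dsum_zero dsum_opp dsum_add.
Proof. by move=> f; apply: dsumP => i; rewrite !mkdsumE addNr. Qed.
HB.instance Definition _ :=
  GRing.isZmodule.Build D dsum_addA dsum_addC dsum_add0 dsum_addN.

Fact dsum_scaleA a b f : dsum_scale a (dsum_scale b f) = dsum_scale (a * b) f.
Proof. by apply: dsumP => i; rewrite !mkdsumE scalerA. Qed.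
Fact dsum_scale1 : left_id 1 dsum_scale.
Proof. by move=> f; apply: dsumP => i; rewrite !mkdsumE scale1r. Qed.
Fact dsum_scaleDr : right_distributive dsum_scale +%R.
Proof. by move=> a f g; apply: dsumP => i; rewrite !mkdsumE scalerDr. Qed.
Fact dsum_scaleDl f : {morph dsum_scale^~ f : a b / a + b}.
Proof. by move=> a b; apply: dsumP => i; rewrite !mkdsumE scalerDl. Qed.
HB.instance Definition _ := GRing.Zmodule_isLmodule.Build F D
  dsum_scaleA dsum_scale1 dsum_scaleDr dsum_scaleDl.

Fact dsum_vect_iso :
  Vector.axiom (\sum_(k < #|I|) dim (T (enum_val k))) D.
Proof.
pose r2f (v : 'rV[F]_(\sum_(k < #|I|) dim (T (enum_val k)))) : D :=
  mkdsum (fun i => r2v (castmx (erefl, congr1 (fun j => dim (T j)) (enum_rankK i))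
                               (submxrow v (enum_rank i)))).
pose f2r (f : D) := \mxrow_(k < #|I|) v2r (f (enum_val k)).
exists f2r => [a f g | ].
  rewrite /f2r; apply/mxrowP => k.
  have lin A B : submxrow (a *: A + B) k = a *: submxrow A k + submxrow B k.
    by apply/matrixP => x y; rewrite !mxE.
  by rewrite lin !mxrowK !mkdsumE linearP.
exists r2f => [f | v].
  apply: dsumP => i; rewrite mkdsumE mxrowK.
  have cast j k (e : j = k) :
      r2v (castmx (erefl, congr1 (fun j => dim (T j)) e) (v2r (f j))) = f k.
    by case: k / e; rewrite castmx_id v2rK.
  exact: cast.
apply/mxrowP => k; rewrite mxrowK mkdsumE r2vK.
have cast j (e : enum_val j = enum_val k) : j = k ->
    castmx (erefl, congr1 (fun j => dim (T j)) e) (submxrow v j) = submxrow v k.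
  by move=> jk; move: e; rewrite jk => e; rewrite eq_axiomK castmx_id.
exact/cast/enum_valK.
Qed.
HB.instance Definition _ := Lmodule_hasFinDim.Build F D dsum_vect_iso.

End DirectSum.

(* Homology at V of a pair of composable maps U --f--> V --g--> W. *)
Definition homology (F : fieldType) (U V W : vectType F)
    (f : 'Hom(U, V)) (g : 'Hom(V, W)) : vectType F := quot (lker g) (limg f).

Record cellComplex (F : fieldType) := CellComplex {
  cell :> finType;
  cell_dim : cell -> nat;
  incidence : cell -> cell -> F;
  incidence_dim : forall t s,
    incidence t s != 0 -> cell_dim t = (cell_dim s).+1;
  incidence_sq : forall t s, \sum_r incidence t r * incidence r s = 0
}.

(* All chain groups live in the total chain space of X, and the boundary is
   the total one.  Degrees are integers, so that C_q and H_q vanish for q < 0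
   without a case distinction. *)
Section Chains.
Variables (F : fieldType) (X : cellComplex F).
Implicit Types (A B : {set X}) (q : int).

Definition total_chains : vectType F := {ffun X -> F^o}.

Definition cell_chain (s : X) : total_chains := [ffun t => (t == s)%:R].

Definition bd : 'End(total_chains) := linfun (fun c : total_chains =>
  \sum_(t : X) (c t : F) *: \sum_(s : X) incidence t s *: cell_chain s).

Definition chains A q : {vspace total_chains} :=
  (\sum_(s in A | (cell_dim s)%:Z == q) <[cell_chain s]>)%VS.

Definition subcomplex A : Prop :=
  forall q, (bd @: chains A q <= chains A (q - 1))%VS.

Definition face_le (s t : X) : bool :=
  connect (fun x y : X => incidence y x != 0) s t.

Definition cycles A q : {vspace total_chains} := (chains A q :&: lker bd)%VS.
Definition boundaries A q : {vspace total_chains} :=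
  (bd @: chains A (q + 1))%VS.

Definition cell_H A q : vectType F := quot (cycles A q) (boundaries A q).

(* Induced by the inclusion of A in B; only meaningful for A \subset B. *)
Definition cell_H_incl A B q : 'Hom(cell_H A q, cell_H B q) :=
  quot_map (cycles A q) (boundaries A q) (cycles B q) (boundaries B q) \1%VF.

Definition rel_chains B A q : vectType F := quot (chains B q) (chains A q).

Definition rel_bd B A q q' : 'Hom(rel_chains B A q, rel_chains B A q') :=
  quot_map (chains B q) (chains A q) (chains B q') (chains A q') bd.

Definition rel_H B A q : vectType F :=
  homology (rel_bd B A (q + 1) q) (rel_bd B A q (q - 1)).

End Chains.

Section Grades.
Variable n : nat.

Definition grade_le (u v : 'rV[int]_n) : bool := [forall j, u 0 j <= v 0 j].

Definition unit_grade (j : 'I_n) : 'rV[int]_n := delta_mx 0 j.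

Definition unit_grade_set (sigma : {set 'I_n}) : 'rV[int]_n :=
  \sum_(j in sigma) unit_grade j.

End Grades.

Record filtration (F : fieldType) (X : cellComplex F) (n : nat) := Filtration {
  stage :> 'rV[int]_n -> {set X};
  stage_subcomplex : forall u, subcomplex (stage u);
  stage_mono : forall u v, grade_le u v -> stage u \subset stage v;
  stage_one_critical : exists f : X -> 'rV[int]_n,
    (forall s t, face_le s t -> grade_le (f s) (f t)) /\
    (forall u, stage u = [set s | grade_le (f s) u]);
  stage_bounded_below : forall u, stage u != set0 -> grade_le 0 u;
  stage_bounded_above : exists v, forall u, grade_le v u -> stage u = setT
}.

(* If j = j_(m-r) in sigma = {j_1 < ... < j_m}, exactly r elements of sigma are
   greater than j, so that this is (-1)^r. *)
Definition removal_sign (R : pzRingType) n (sigma : {set 'I_n}) (j : 'I_n) : R :=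
  (-1) ^+ #|[set k in sigma | (j < k)%N]|.

Section MorseAndBetti.
Variables (F : fieldType) (X : cellComplex F) (n : nat) (Xf : filtration X n).
Variable u : 'rV[int]_n.
Implicit Types (i q : int).

Definition morse q : nat :=
  \dim {: rel_H (Xf u) (\bigcup_(j < n) Xf (u - unit_grade j)) q}.

Definition subsets_of_size i := {sigma : {set 'I_n} | #|sigma|%:Z == i}.

Definition koszul i q : vectType F :=
  dsum (fun sigma : subsets_of_size i =>
    cell_H (Xf (u - unit_grade_set (val sigma))) q).

(* The differential K_i -> K_(i-1), obtained for i' = i - 1. *)
Definition koszul_d q i i' : 'Hom(koszul i q, koszul i' q) :=
  linfun (fun c : koszul i q => mkdsum (fun tau : subsets_of_size i' =>
    \sum_(sigma : subsets_of_size i)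
      \sum_(j in val sigma | val sigma :\ j == val tau)
        removal_sign F (val sigma) j *:
        cell_H_incl (Xf (u - unit_grade_set (val sigma)))
          (Xf (u - unit_grade_set (val tau))) q (c sigma)) : koszul i' q).

Definition betti i q : nat :=
  \dim {: homology (koszul_d q (i + 1) i) (koszul_d q i (i - 1))}.

End MorseAndBetti.

(* The double complex C_(p,q) is an internal direct sum in the space of
   families, indexed by the subsets sigma of [n], of total chains of X: the
   summand of sigma consists of the families supported at sigma. *)
Section MayerVietoris.
Variables (F : fieldType) (X : cellComplex F) (n : nat) (Xf : filtration X n).
Variable u : 'rV[int]_n.
Implicit Types (p q k r : int) (sigma tau : {set 'I_n}).

Definition mv_space : vectType F := {ffun {set 'I_n} -> total_chains X}.

Definition mv_inj sigma : 'Hom(total_chains X, mv_space) :=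
  linfun (fun c : total_chains X =>
    [ffun tau => if tau == sigma then c else 0] : mv_space).

Definition mv_C p q : {vspace mv_space} :=
  if 0 <= p then
    (\sum_(sigma : {set 'I_n} | #|sigma|%:Z == (p + 1)%R)
       mv_inj sigma @: chains (\bigcap_(j in sigma) Xf (u - unit_grade j)) q)%VS
  else 0%VS.

Definition mv_horizontal : 'End(mv_space) := linfun (fun c : mv_space =>
  \sum_(sigma : {set 'I_n} | (1 < #|sigma|)%N) \sum_(j in sigma)
    removal_sign F sigma j *: mv_inj (sigma :\ j) (c sigma)).

Definition mv_vertical : 'End(mv_space) := linfun (fun c : mv_space =>
  \sum_(sigma : {set 'I_n} | (0 < #|sigma|)%N)
    (-1) ^+ #|sigma|.-1 *: mv_inj sigma (bd X (c sigma))).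

Definition mv_D : 'End(mv_space) := mv_horizontal + mv_vertical.

(* F^I_p T_k; the columns i >= n of the double complex vanish. *)
Definition mv_filt p k : {vspace mv_space} :=
  (\sum_(i < n | ((i : nat)%:Z <= p)%R) mv_C i%:Z (k - i%:Z)%R)%VS.

(* Z^r_(p,q) = {x in F_p T_(p+q) | D x in F_(p-r) T_(p+q-1)}. *)
Definition ss_Z r p q : {vspace mv_space} :=
  (mv_filt p (p + q) :&: mv_D @^-1: mv_filt (p - r) (p + q - 1))%VS.

(* D Z^(r-1)_(p+r-1,q-r+2) + Z^(r-1)_(p-1,q+1). *)
Definition ss_B r p q : {vspace mv_space} :=
  (mv_D @: ss_Z (r - 1) (p + r - 1) (q - r + 2)
   + ss_Z (r - 1) (p - 1) (q + 1))%VS.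

Definition ss_E r p q : vectType F := quot (ss_Z r p q) (ss_B r p q).

Definition ss_d r p q : 'Hom(ss_E r p q, ss_E r (p - r) (q + r - 1)) :=
  quot_map (ss_Z r p q) (ss_B r p q)
    (ss_Z r (p - r) (q + r - 1)) (ss_B r (p - r) (q + r - 1)) mv_D.

Definition rank_d r p q : nat := \dim (limg (ss_d r p q)).

End MayerVietoris.

(* Main.v *)
Require Import Defs.
From HB Require Import structures.
From mathcomp Require Import all_boot all_order all_algebra.
From mathcomp Require Import zify ring.

Import Order.TTheory GRing.Theory Num.Theory.
Local Open Scope ring_scope.

(** Write [X_j] for the subcomplex at grade [u - e_j] and [A] for the union of
    the [X_j].  The long exact sequence of the pair writes mu_q(u) as the
    dimension of the cokernel of H_q(A) -> H_q(X^u) plus that of the kernel of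
    H_(q-1)(A) -> H_(q-1)(X^u).  The Mayer-Vietoris total complex T computes
    H(A), because the double complex augmented by the column C(A) has
    contractible rows.  The cokernel is estimated by comparing H_q(A) with its
    subspace F_0 H_q(A), whose codimension is the sum of the E^infty terms off
    the column 0; the kernel by restricting to F_0 H_(q-1)(A) = E^infty_(0,q-1).
    Finally dim E^infty is dim E^2 minus the ranks of the differentials entering
    and leaving, and the E^2 terms are the homology of the Koszul complex, except
    in the column 0, where the rank of K_1 -> K_0 has to be added.

    Everything is phrased with dimensions of subspaces.  In particular the pages
    of the spectral sequence enter only through the numbers dim Z^r_(p,q), in
    which both dim E^r and rank d^r are linear. *)

(** * Dimension counts for subquotients and induced maps *)

Section LinearAlgebra.
Variables (F : fieldType).
Implicit Types (V W : vectType F).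

Lemma dim_quot V (Z B : {vspace V}) :
  (B <= Z)%VS -> (\dim {: quot Z B} + \dim B = \dim Z)%N.
Proof.
move=> BZ; rewrite dimvf /= -[RHS](dimv_cap_compl Z B) addnC.
by rewrite (capv_idPr BZ).
Qed.

Lemma limg_cls V (Z B : {vspace V}) : (cls Z B @: Z)%VS = fullv.
Proof.
apply/eqP; rewrite eqEsubv subvf /=; apply/subvP => x _.
by rewrite -(cls_rep x) memv_img // rep_mem.
Qed.

Lemma dim_limg_cls V (Z B U : {vspace V}) : (U <= Z)%VS ->
  (\dim (cls Z B @: U) + \dim B = \dim (U + B))%N.
Proof.
move=> UZ; have := limg_ker_dim (cls Z B) U; have := dimv_sum_cap U B.
suff -> : (U :&: lker (cls Z B) = U :&: B)%VS by lia.
apply/vspaceP => x; rewrite !memv_cap; apply: andb_id2l => xU.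
by rewrite memv_ker cls_eq0 //; apply: subvP xU.
Qed.

(** The image of the induced map is (f Z + B') / B', so its rank is read off from subspaces of W
    alone. *)
Lemma dim_limg_quot_map V W (Z B : {vspace V}) (Z' B' : {vspace W})
    (f : 'Hom(V, W)) :
  (f @: Z <= Z')%VS -> (f @: B <= B')%VS ->
  (\dim (limg (quot_map Z B Z' B' f)) + \dim B' = \dim (f @: Z + B'))%N.
Proof.
move=> fZ fB; rewrite -(dim_limg_cls _ _ _ _ fZ); congr (_ + _)%N.
rewrite -(limg_cls _ Z B) -!limg_comp; congr (\dim _).
by apply: eq_in_limg => x xZ; rewrite !comp_lfunE quot_map_cls.
Qed.

Lemma dim_homology (U V W : vectType F) (f : 'Hom(U, V)) (g : 'Hom(V, W)) :
  (limg f <= lker g)%VS ->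
  (\dim {: homology f g} + \dim (limg f) + \dim (limg g) = \dim {:V})%N.
Proof.
move=> fg; have /= := dim_quot _ _ _ fg; rewrite -/(homology f g) => ->.
by have := limg_ker_dim g fullv; rewrite capfv.
Qed.

(* The map [U / U' -> W / W'] induced by [f] is onto when [f U + W' = W], and
   [U'] lies in its kernel. *)
Lemma codim_surj V W (f : 'Hom(V, W)) (U U' : {vspace V}) (W1 W2 : {vspace W}) :
  (U' <= U)%VS -> (W1 <= f @: U + W2)%VS -> (W2 <= W1)%VS -> (f @: U' <= W2)%VS ->
  (\dim W1 + \dim U' <= \dim U + \dim W2)%N.
Proof.
move=> U'U W1U W21 fU'.
have := dimvS W1U; have := dimv_sum_cap (f @: U)%VS W2.
have := limg_ker_dim f U; have := limg_ker_dim f U'.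
have h : (U' :&: lker f <= U :&: lker f)%VS by apply: capvS.
have := dimvS h.
have h2 : (f @: U' <= f @: U :&: W2)%VS by rewrite subv_cap fU' limgS.
have := dimvS h2; lia.
Qed.

(* Dually, the map induced by [f] is injective. *)
Lemma codim_inj V W (f : 'Hom(V, W)) (U U' : {vspace V}) (W1 W2 : {vspace W}) :
  (f @: U <= W1)%VS -> (W2 <= W1)%VS -> (U :&: f @^-1: W2 <= U')%VS ->
  (\dim U + \dim W2 <= \dim W1 + \dim U')%N.
Proof.
move=> fU W21 UW2.
have h0 : (f @: U + W2 <= W1)%VS by rewrite subv_add fU W21.
have := dimvS h0; have := dimv_sum_cap (f @: U)%VS W2.
have := limg_ker_dim f U.
have := dimvS UW2; have := limg_ker_dim f (U :&: f @^-1: W2)%VS.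
have -> : (f @: (U :&: f @^-1: W2) = f @: U :&: W2)%VS.
  apply/eqP; rewrite eqEsubv; apply/andP; split.
    apply: subv_trans (limg_cap _ _ _) _; apply: capvS => //.
    by apply/subvP => _ /memv_imgP[x xW ->]; move: xW; rewrite -memv_preim.
  apply/subvP => y; rewrite memv_cap => /andP[/memv_imgP[x xU ->]] xW.
  by apply: memv_img; rewrite memv_cap xU -memv_preim.
have h : ((U :&: f @^-1: W2) :&: lker f = U :&: lker f)%VS.
  apply/vspaceP => x; rewrite !memv_cap -memv_preim memv_ker -andbA.
  by case: eqP => [->|_]; rewrite ?mem0v ?andbF.
rewrite h; lia.
Qed.

End LinearAlgebra.

(** * The spectral sequence of a filtered complex *)

Section FilteredComplex.
Variables (F : fieldType) (V : vectType F) (D : 'End(V)).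
Variable Fil : int -> int -> {vspace V}.
Hypothesis DD : forall x, D (D x) = 0.
Hypothesis Fil_mono : forall p p' k, p <= p' -> (Fil p k <= Fil p' k)%VS.
Implicit Types (r p k : int).

(** The second index is the total degree k = p + q: D lowers it by one whatever the page, and only p
    moves with r. *)
Definition fil_Z r p k := (Fil p k :&: D @^-1: Fil (p - r) (k - 1))%VS.
Definition fil_B r p k :=
  (D @: fil_Z (r - 1) (p + r - 1) (k + 1) + fil_Z (r - 1) (p - 1) k)%VS.

Definition dimZ r p k : int := (\dim (fil_Z r p k))%:Z.

(** This is dim Z^r_p - dim (Z^(r+1)_p + Z^(r-1)_(p-1)), the two summands meeting in Z^r_(p-1); it
    is the rank of d^r leaving filtration degree p. *)
Definition rank_fil r p k : int :=
  dimZ r p k - dimZ (r + 1) p k - dimZ (r - 1) (p - 1) k + dimZ r (p - 1) k.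

(** This is dim Z^r_p - dim B^r_p. The two summands of B^r_p meet in D Z^r_(p+r-1), and
    Z^(r-1)_(p+r-1) and Z^r_(p+r-1) contain the same cycles, so the dimensions of their images
    differ as their own do. *)
Definition dimE r p k : int :=
  dimZ r p k - dimZ (r - 1) (p - 1) k
  - dimZ (r - 1) (p + r - 1) (k + 1) + dimZ r (p + r - 1) (k + 1).

(** Passing to the next page loses the rank of the differential leaving E^r_p and that of the one
    entering it from p + r; in terms of [dimZ] this is mere cancellation. *)
Lemma dimE_step r p k :
  dimE r p k - dimE (r + 1) p k = rank_fil r p k + rank_fil r (p + r) (k + 1).
Proof.
rewrite /dimE /rank_fil.
have -> : r + 1 - 1 = r by ring.
have -> : p + (r + 1) - 1 = p + r by ring.
ring.
Qed.

Lemma mem_fil_Z r p k x :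
  (x \in fil_Z r p k) = (x \in Fil p k) && (D x \in Fil (p - r) (k - 1)).
Proof. by rewrite memv_cap -memv_preim. Qed.

Lemma fil_Z_img_mem r p k x : x \in fil_Z r p k ->
  forall s, D x \in fil_Z s (p - r) (k - 1).
Proof. by rewrite mem_fil_Z => /andP[_ xF] s; rewrite mem_fil_Z DD mem0v xF. Qed.

Lemma fil_Z_sub r p k : (fil_Z (r - 1) (p - 1) k <= fil_Z r p k)%VS.
Proof.
apply/subvP => x; rewrite !mem_fil_Z => /andP[xF].
have -> : p - 1 - (r - 1) = p - r by ring.
by move=> ->; rewrite (subvP (Fil_mono _ _ _ _) _ xF) //; lia.
Qed.

Lemma limg_fil_Z r p k s : (D @: fil_Z r p k <= fil_Z s (p - r) (k - 1))%VS.
Proof. by apply/subvP => _ /memv_imgP[x xZ ->]; apply: fil_Z_img_mem. Qed.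

Lemma limg_fil_B r p k : (D @: fil_B r p k <= fil_B r (p - r) (k - 1))%VS.
Proof.
rewrite limgD subv_add; apply/andP; split.
  by apply/subvP => _ /memv_imgP[_ /memv_imgP[x _ ->] ->]; rewrite DD mem0v.
rewrite /fil_B.
have -> : p - r + r - 1 = p - 1 by ring.
have -> : k - 1 + 1 = k by ring.
exact: addvSl.
Qed.

(** A cycle has boundary 0, which lies in every filtration step. As the kernel of D on Z^r_p does
    not depend on r, kernel terms cancel in comparisons between pages. *)
Lemma fil_Z_ker r p k :
  (fil_Z r p k :&: lker D = Fil p k :&: lker D)%VS.
Proof.
apply/vspaceP => x; rewrite !memv_cap -memv_preim memv_ker.
by case: eqP => [->|_]; rewrite ?mem0v ?andbF ?andbT.
Qed.

(* The kernel of the r-th differential is the image of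
   Z^(r+1)_p + Z^(r-1)_(p-1), and these two spaces meet in Z^r_(p-1). *)
Lemma dim_limg_fil r p k :
  (\dim (D @: fil_Z r p k + fil_B r (p - r) (k - 1)))%:Z =
    rank_fil r p k + (\dim (fil_B r (p - r) (k - 1)))%:Z.
Proof.
pose U := (fil_Z (r + 1) p k + fil_Z (r - 1) (p - 1) k)%VS.
have U1 : (fil_Z (r + 1) p k <= fil_Z r p k)%VS.
  apply/subvP => x; rewrite !mem_fil_Z => /andP[->] h /=.
  by apply: subvP h; apply: Fil_mono; lia.
have UZ : (U <= fil_Z r p k)%VS by rewrite subv_add U1 fil_Z_sub.
have kerU : (U :&: lker D = Fil p k :&: lker D)%VS.
  apply/eqP; rewrite eqEsubv -{1}(fil_Z_ker r) capvS //=.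
  by rewrite -(fil_Z_ker (r + 1)) capvS // addvSl.
have capU : (fil_Z (r + 1) p k :&: fil_Z (r - 1) (p - 1) k = fil_Z r (p - 1) k)%VS.
  apply/vspaceP => x; rewrite memv_cap !mem_fil_Z.
  have -> : p - (r + 1) = p - 1 - r by ring.
  apply/idP/idP => [/andP[/andP[_ ->] /andP[->]] // | /andP[xF dx]].
  rewrite xF dx (subvP (Fil_mono _ _ _ _) _ xF) /=; last by lia.
  by apply: subvP dx; apply: Fil_mono; lia.
have imgU : (D @: fil_Z r p k :&: fil_B r (p - r) (k - 1) = D @: U)%VS.
  have Be : (fil_B r (p - r) (k - 1) = D @: fil_Z (r - 1) (p - 1) k
       + fil_Z (r - 1) (p - r - 1) (k - 1))%VS.
    by rewrite /fil_B; congr (D @: fil_Z _ _ _ + _)%VS; ring.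
  apply/eqP; rewrite eqEsubv; apply/andP; split; last first.
    rewrite subv_cap limgS //= Be limgD subv_add addvSl andbT.
    apply: subv_trans (addvSr _ _).
    have := limg_fil_Z (r + 1) p k (r - 1).
    by have -> : p - (r + 1) = p - r - 1 by ring.
  apply/subvP => y; rewrite memv_cap => /andP[/memv_imgP[x xZ ->{y}]].
  rewrite Be => /memv_addP[_ /memv_imgP[y yZ ->] [z zZ Dx]].
  (* With D x = D y + z, the difference x - y has boundary z in F_(p-r-1), hence lies in Z^(r+1)_p,
     and x = (x - y) + y lies in U. *)
  rewrite -[x](subrK y) linearD /=.
  have xyZ : x - y \in fil_Z (r + 1) p k.
    have Dxy : D (x - y) = z by rewrite linearB /= Dx addrC addKr.
    move: xZ yZ zZ; rewrite !mem_fil_Z Dxy.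
    have -> : p - (r + 1) = p - r - 1 by ring.
    move=> /andP[xF _] /andP[yF _] /andP[-> _]; rewrite andbT.
    by rewrite memvB // (subvP (Fil_mono _ _ _ _) _ yF) //; lia.
  rewrite limgD -linearD /= linearD /= memv_add //; first exact: memv_img.
  exact: memv_img.
have := dimv_sum_cap (D @: fil_Z r p k)%VS (fil_B r (p - r) (k - 1)).
rewrite imgU.
have := limg_ker_dim D (fil_Z r p k); rewrite fil_Z_ker.
have := limg_ker_dim D U; rewrite kerU.
have := dimv_sum_cap (fil_Z (r + 1) p k) (fil_Z (r - 1) (p - 1) k).
rewrite capU -/U /rank_fil /dimZ; lia.
Qed.

Lemma rank_quot_map_fil r p k :
  (\dim (limg (quot_map (fil_Z r p k) (fil_B r p k)
    (fil_Z r (p - r) (k - 1)) (fil_B r (p - r) (k - 1)) D)))%:Z = rank_fil r p k.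
Proof.
have := dim_limg_quot_map _ _ _ _ _ _ _ _ (limg_fil_Z r p k r) (limg_fil_B r p k).
have := dim_limg_fil r p k; lia.
Qed.

(* Beyond the length of the filtration, the dimensions of the pages telescope
   to those of the graded pieces of homology. *)
Lemma dimE_infty (m N : int) :
  (forall p k, p < 0 -> Fil p k = 0%VS) ->
  (forall p k, m <= p -> Fil p k = Fil m k) -> m < N ->
  forall p k, 0 <= p <= m ->
  dimE N p k =
   (\dim (Fil p k :&: lker D))%:Z - (\dim (Fil (p - 1) k :&: lker D))%:Z
   - (\dim (Fil p k :&: D @: Fil m (k + 1)))%:Z
   + (\dim (Fil (p - 1) k :&: D @: Fil m (k + 1)))%:Z.
Proof.
move=> F0 Fm mN p k /andP[p0 pm].
(* Here the target filtration step is zero, so Z consists of the cycles of F_t. *)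
have low (s t : int) : t - s < 0 -> dimZ s t k = (\dim (Fil t k :&: lker D))%:Z.
  move=> ts; by rewrite /dimZ /fil_Z (F0 (t - s)) // lpreim0.
(* Here F_t is everything, so D maps Z^s_t onto the boundaries lying in F_(t-s), with all cycles as
   kernel. *)
have high (s t : int) : m <= t -> dimZ s t (k + 1) =
    (\dim (Fil m (k + 1) :&: lker D))%:Z
    + (\dim (Fil (t - s) k :&: D @: Fil m (k + 1)))%:Z.
  move=> mt; rewrite /dimZ.
  have := limg_ker_dim D (fil_Z s t (k + 1)); rewrite fil_Z_ker Fm // => <-.
  rewrite PoszD; congr (_ + Posz (\dim _)).
  apply/vspaceP => y; rewrite memv_cap.
  apply/memv_imgP/andP => [[x] | [yF /memv_imgP[x xF yx]]].
    rewrite mem_fil_Z Fm //; have -> : k + 1 - 1 = k by ring.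
    by move=> /andP[xF xD] ->; split=> //; apply: memv_img.
  exists x => //; rewrite mem_fil_Z Fm // xF -yx.
  by have -> : k + 1 - 1 = k by ring.
rewrite /dimE !low ?high; try lia.
have -> : p + N - 1 - (N - 1) = p by ring.
have -> : p + N - 1 - N = p - 1 by ring.
ring.
Qed.

End FilteredComplex.

(** Evaluates a map defined by [linfun] on a bare function from a proof of linearity, with no
    structure to be declared for that function. *)
Lemma linfun_linearE (F : fieldType) (U V : vectType F) (f : U -> V) :
  linear f -> linfun f =1 f.
Proof.
move=> lin; pose m := GRing.isLinear.Build _ _ _ _ _ lin.
pose g : {linear U -> V} := HB.pack f m.
exact: (lfunE g).
Qed.

(** * Chains, cycles and boundaries of a cell complex *)

Section CellChains.
Variables (F : fieldType) (X : cellComplex F).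
Implicit Types (A B : {set X}) (c : total_chains X) (s t : X) (q : int).

Lemma total_chain_sum c : c = \sum_s c s *: cell_chain s.
Proof.
apply/ffunP => t; rewrite sum_ffunE (bigD1 t) //= big1 => [|s st].
  by rewrite !ffunE eqxx addr0 [RHS]mulr1.
by rewrite !ffunE eq_sym (negPf st) scaler0.
Qed.

Lemma bdE c s : bd X c s = \sum_t (c t : F) * incidence t s.
Proof.
rewrite linfun_linearE => [|a x y].
  rewrite sum_ffunE; apply: eq_bigr => t _; rewrite ffunE sum_ffunE (bigD1 s) //=.
  rewrite big1 => [|r rs]; first by rewrite !ffunE eqxx addr0 [_ *: 1]mulr1.
  by rewrite !ffunE eq_sym (negPf rs) scaler0.
rewrite scaler_sumr -big_split; apply: eq_bigr => t _ /=.
by rewrite !ffunE scalerDl scalerA.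
Qed.

Lemma bd_bd c : bd X (bd X c) = 0.
Proof.
apply/ffunP => s; rewrite bdE ffunE.
under eq_bigr => t _ do rewrite bdE mulr_suml.
rewrite exchange_big big1 //= => t _.
under eq_bigr => r _ do rewrite -mulrA.
by rewrite -mulr_sumr incidence_sq mulr0.
Qed.

(** Reduces membership to a condition on supports, which is how inclusions of subcomplexes and the
    contracting homotopy are handled. *)
Lemma mem_chains A q c :
  reflect (forall s, c s != 0 -> s \in A /\ (cell_dim s)%:Z = q) (c \in chains A q).
Proof.
apply: (iffP idP) => [/memv_sumP[v vP ->] t | cP]; last first.
  rewrite (total_chain_sum c) memv_suml // => s _.
  have [-> | /cP[sA sq]] := eqVneq (c s) 0; first by rewrite scale0r mem0v.
  apply: memvZ; apply: subvP (memv_line _).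
  by apply: (sumv_sup s) => //; rewrite sA sq eqxx.
have [/andP[tA /eqP tq] // | tAq] := boolP ((t \in A) && ((cell_dim t)%:Z == q)).
rewrite sum_ffunE big1 ?eqxx // => s sAq.
have /vlineP[k ->] := vP s sAq; rewrite !ffunE.
by case: (eqVneq t s) tAq => [->|]; rewrite ?sAq ?scaler0.
Qed.

Lemma chainsS A B q : A \subset B -> (chains A q <= chains B q)%VS.
Proof.
move=> /subsetP AB; apply/subvP => c /mem_chains cP; apply/mem_chains => s /cP[sA ->].
by split=> //; apply: AB.
Qed.

Lemma subcomplex_bd A q c : subcomplex A -> c \in chains A q -> bd X c \in chains A (q - 1).
Proof. by move=> sA cA; apply: subvP (sA q) _ (memv_img _ cA). Qed.

Lemma subcomplex_bigcup (I : finType) (A : I -> {set X}) :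
  (forall i, subcomplex (A i)) -> subcomplex (\bigcup_i A i).
Proof.
move=> sA q; rewrite {1}/chains limg_sum; apply/subv_sumP => s /andP[/bigcupP[i _ si] sq].
apply: subv_trans (chainsS _ _ _ (bigcup_sup i isT)); apply: subv_trans (sA i q).
by apply: limgS; apply: (sumv_sup s); rewrite ?si.
Qed.

Lemma boundaries_sub_cycles A q : subcomplex A -> (boundaries A q <= cycles A q)%VS.
Proof.
move=> sA; apply/subvP => _ /memv_imgP[c cA ->].
rewrite memv_cap memv_ker bd_bd eqxx andbT -[q](addrK 1); exact: subcomplex_bd.
Qed.

Lemma cyclesS A B q : A \subset B -> (cycles A q <= cycles B q)%VS.
Proof. by move=> AB; apply: capvS (chainsS _ _ _ AB) (subvv _). Qed.

Lemma boundariesS A B q : A \subset B -> (boundaries A q <= boundaries B q)%VS.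
Proof. by move=> AB; apply: limgS; apply: chainsS. Qed.

End CellChains.

(** * Signs of the horizontal differential *)

Section RemovalSign.
Variables (R : comPzRingType) (n : nat).
Implicit Types (sigma : {set 'I_n}) (j k : 'I_n).

Lemma removal_sign_sq sigma j : removal_sign R sigma j * removal_sign R sigma j = 1.
Proof. by rewrite -expr2 sqrr_sign. Qed.

Lemma removal_sign1 j : removal_sign R [set j] j = 1.
Proof.
rewrite /removal_sign (_ : [set _ in _ | _] = set0) ?cards0 //.
by apply/setP => k; rewrite !inE; case: eqP => // ->; rewrite ltnn.
Qed.

(** For j < k, removing k first lowers by one the number of elements above j, while removing j first
    leaves the number above k unchanged. *)
Lemma removal_signC sigma j k : j \in sigma -> k \in sigma -> j != k ->
  removal_sign R sigma j * removal_sign R (sigma :\ j) k =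
  - (removal_sign R sigma k * removal_sign R (sigma :\ k) j).
Proof.
move=> js ks jk; wlog ltjk : j k js ks jk / (j < k)%N.
  move=> W; have [lt|lt|/val_inj e] := ltngtP j k; first exact: W.
    by rewrite [in RHS]W ?opprK // eq_sym.
  by rewrite e eqxx in jk.
rewrite /removal_sign.
rewrite [in RHS]mulrC.
have -> : [set i in sigma :\ j | (k < i)%N] = [set i in sigma | (k < i)%N].
  apply/setP => i; rewrite !inE; case: eqP => // ->.
  by rewrite ltnNge (ltnW ltjk) /= andbF.
have -> : [set i in sigma | (j < i)%N] = k |: [set i in sigma :\ k | (j < i)%N].
  by apply/setP => i; rewrite !inE; case: eqP => // ->; rewrite ks ltjk.
by rewrite cardsU1 !inE eqxx exprS mulN1r mulNr.
Qed.

End RemovalSign.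

(** * The augmented Mayer-Vietoris complex *)

Section Families.
Variables (F : fieldType) (X : cellComplex F) (n : nat).
Implicit Types (c : mv_space X n) (sigma tau : {set 'I_n}).
Implicit Types (W : {set 'I_n} -> {vspace total_chains X}).

Lemma mv_injE sigma (x : total_chains X) tau :
  mv_inj X sigma x tau = if tau == sigma then x else 0.
Proof.
rewrite linfun_linearE => [|a y z]; first by rewrite ffunE.
by apply/ffunP => t; rewrite !ffunE; case: eqP => // _; rewrite scaler0 addr0.
Qed.

Lemma family_sum c : c = \sum_sigma mv_inj X sigma (c sigma).
Proof.
apply/ffunP => tau; rewrite sum_ffunE (bigD1 tau) //= mv_injE eqxx.
by rewrite big1 ?addr0 // => sigma st; rewrite mv_injE eq_sym (negPf st).
Qed.

Definition family_space W : {vspace mv_space X n} :=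
  (\sum_sigma mv_inj X sigma @: W sigma)%VS.

Lemma mem_family_space W c :
  reflect (forall sigma, c sigma \in W sigma) (c \in family_space W).
Proof.
apply: (iffP idP) => [/memv_sumP[v vP ->] tau | cP]; last first.
  rewrite (family_sum c) memv_suml // => s _; apply: (subvP (sumv_sup s _ _)) => //.
  exact: memv_img.
rewrite sum_ffunE memv_suml // => s _; have /memv_imgP[x xW ->] := vP s isT.
by rewrite mv_injE; case: eqP => [->|]; rewrite ?mem0v.
Qed.

(* The horizontal differential of the Mayer-Vietoris double complex augmented
   by a column of index -1, indexed by the empty set. *)
Definition aug_hor : 'End(mv_space X n) := linfun (fun c : mv_space X n =>
  [ffun tau : {set 'I_n} => \sum_(j | j \notin tau) removal_sign F (j |: tau) j *: c (j |: tau)]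
  : mv_space X n).

(** The exponent has the parity of the column index #|tau| - 1, and also makes sense in the column
    -1. *)
Definition aug_ver : 'End(mv_space X n) := linfun (fun c : mv_space X n =>
  [ffun tau : {set 'I_n} => (-1) ^+ #|tau|.+1 *: bd X (c tau)] : mv_space X n).

Definition aug_D : 'End(mv_space X n) := aug_hor + aug_ver.

Lemma aug_horE c tau : aug_hor c tau =
  \sum_(j | j \notin tau) removal_sign F (j |: tau) j *: c (j |: tau).
Proof.
rewrite linfun_linearE => [|a x y]; first by rewrite ffunE.
apply/ffunP => t; rewrite !ffunE scaler_sumr -big_split.
apply: eq_bigr => j _ /=; rewrite !ffunE scalerDr !scalerA mulrC.
by [].
Qed.

Lemma aug_verE c tau : aug_ver c tau = (-1) ^+ #|tau|.+1 *: bd X (c tau).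
Proof.
rewrite linfun_linearE => [|a x y]; first by rewrite ffunE.
apply/ffunP => t; rewrite !ffunE linearP scalerDr !scalerA mulrC.
by [].
Qed.

Lemma aug_DE c tau : aug_D c tau = aug_hor c tau + aug_ver c tau.
Proof. by rewrite add_lfunE ffunE. Qed.

Lemma aug_hor_hor c : aug_hor (aug_hor c) = 0.
Proof.
apply/ffunP => tau; rewrite aug_horE [RHS]ffunE.
pose f j k := removal_sign F (j |: tau) j *:
  (removal_sign F (k |: (j |: tau)) k *: c (k |: (j |: tau))).
transitivity (\sum_(j | j \notin tau) \sum_(k | (k \notin tau) && (k != j)) f j k).
  apply: eq_bigr => j _; rewrite aug_horE scaler_sumr.
  by apply: eq_bigl => k; rewrite !inE negb_or andbC.
have fC j k : j \notin tau -> k \notin tau -> k != j -> f j k = - f k j.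
  move=> jt kt kj; rewrite /f !scalerA -scaleNr setUCA; congr (_ *: _).
  have := @removal_signC F n (j |: (k |: tau)) j k.
  rewrite !inE !eqxx !orbT eq_sym => /(_ isT isT kj).
  rewrite setU1K ?inE ?negb_or ?(eq_sym j) ?kj //.
  rewrite [X in X :\ k]setUCA setU1K ?inE ?negb_or ?kj // mulrC => e.
  by rewrite mulrC -[LHS]opprK -e.
(* Splitting the pairs into k < j and j < k and exchanging the sums in one half matches f j k with f
   k j, its opposite. *)
rewrite (eq_bigr (fun j : 'I_n => \sum_(k | (k \notin tau) && (k < j)%N) f j k +
   \sum_(k | (k \notin tau) && (j < k)%N) f j k)); last first.
  move=> j _; rewrite (bigID (fun k : 'I_n => (k < j)%N)) /=; congr (_ + _).
    apply: eq_bigl => k; rewrite -andbA; congr (_ && _).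
    by case: ltngtP => [||/val_inj->]; rewrite ?andbF ?eqxx // -val_eqE => /ltn_eqF->.
  apply: eq_bigl => k; rewrite -andbA; congr (_ && _).
  by rewrite -leqNgt ltn_neqAle -val_eqE eq_sym.
rewrite big_split /= addrC (exchange_big_dep (fun k => k \notin tau)) /=; last first.
  by move=> j k _ /andP[].
rewrite -big_split big1 // => k kt /=.
rewrite (eq_bigl (fun j => (j \notin tau) && (j < k)%N)); last first.
  by move=> j; rewrite kt.
rewrite -big_split big1 // => j /andP[jt jk] /=; rewrite fC ?addNr //.
by rewrite -val_eqE neq_ltn jk orbT.
Qed.

Lemma aug_ver_ver c : aug_ver (aug_ver c) = 0.
Proof. by apply/ffunP => tau; rewrite !aug_verE linearZ /= bd_bd !scaler0 ffunE. Qed.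

(** Inclusions commute with [bd]; the minus sign comes from the sizes of tau and j |: tau, which
    differ by one. *)
Lemma aug_hor_ver c : aug_hor (aug_ver c) = - aug_ver (aug_hor c).
Proof.
apply/ffunP => tau; rewrite [RHS]ffunE aug_verE !aug_horE linear_sum -scalerN.
rewrite -sumrN scaler_sumr; apply: eq_bigr => j jt.
by rewrite aug_verE !linearZ /= cardsU1 jt exprS mulN1r scaleNr !scalerN !scalerA mulrC.
Qed.

Lemma aug_D_D c : aug_D (aug_D c) = 0.
Proof.
rewrite !add_lfunE !linearD /= aug_hor_hor aug_ver_ver aug_hor_ver.
by rewrite add0r addr0 addNr.
Qed.

Lemma mv_horizontalE c tau :
  mv_horizontal X n c tau = if tau == set0 then 0 else aug_hor c tau.
Proof.
rewrite linfun_linearE => [|a x y]; last first.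
  rewrite scaler_sumr -big_split; apply: eq_bigr => s _ /=.
  rewrite scaler_sumr -big_split; apply: eq_bigr => j _ /=.
  by rewrite !ffunE linearP scalerDr !scalerA mulrC.
rewrite sum_ffunE aug_horE; under eq_bigr => s _ do rewrite sum_ffunE.
case: eqP => [-> | /eqP tau0].
  rewrite big1 // => s s1; rewrite big1 // => j js; rewrite ffunE mv_injE.
  case: eqP => [e|]; last by rewrite scaler0.
  by move: s1; rewrite (cardsD1 j) js -e cards0.
(* For a fixed target tau and vertex j, the only contributing source is j |: tau, and only when j is
   not in tau. *)
rewrite (exchange_big_dep xpredT) //= [RHS]big_mkcond; apply: eq_bigr => j _.
have [jt | jt] := ifPn.
  rewrite (bigD1 (j |: tau)) /=; last first.
    by rewrite !inE eqxx cardsU1 jt andbT ltnS card_gt0.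
  rewrite ffunE mv_injE setU1K // eqxx big1 ?addr0 // => s /andP[/andP[_ js] sj].
  rewrite ffunE mv_injE; case: eqP => [e|]; last by rewrite scaler0.
  by rewrite e setD1K // eqxx in sj.
rewrite big1 // => s /andP[_ js]; rewrite ffunE mv_injE; case: eqP => [e|].
  by rewrite e !inE eqxx in jt.
by rewrite scaler0.
Qed.

Lemma mv_verticalE c tau :
  mv_vertical X n c tau = if tau == set0 then 0 else aug_ver c tau.
Proof.
rewrite linfun_linearE => [|a x y]; last first.
  rewrite scaler_sumr -big_split; apply: eq_bigr => s _ /=.
  by rewrite !ffunE !linearP.
rewrite sum_ffunE; case: eqP => [-> | /eqP tau0].
  rewrite big1 // => s s0; rewrite ffunE mv_injE eq_sym -cards_eq0 -leqn0 leqNgt s0.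
  by rewrite scaler0.
rewrite (bigD1 tau) ?card_gt0 //= ffunE mv_injE eqxx aug_verE big1 => [|s /andP[_ st]].
  have : (0 < #|tau|)%N by rewrite card_gt0.
  by case: #|tau| => // m _; rewrite !exprS !mulN1r opprK addr0.
by rewrite ffunE mv_injE eq_sym (negPf st) scaler0.
Qed.

Lemma mv_DE c tau : mv_D X n c tau = if tau == set0 then 0 else aug_D c tau.
Proof.
rewrite add_lfunE ffunE mv_horizontalE mv_verticalE aug_DE.
by case: ifP => _; rewrite ?addr0.
Qed.

(** The column -1 is a subcomplex of the augmented complex: away from the empty set the differential
    does not see it. [mv_D] is the differential of the quotient, and inherits from [aug_D] that its
    square is zero. *)
Lemma aug_D_local c c' tau : tau != set0 ->
  (forall sigma, sigma != set0 -> c sigma = c' sigma) -> aug_D c tau = aug_D c' tau.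
Proof.
move=> t0 cc'; rewrite !aug_DE !aug_horE !aug_verE cc' //; congr (_ + _).
apply: eq_bigr => j jt; rewrite cc' //; apply/set0Pn; exists j.
by rewrite !inE eqxx.
Qed.

Lemma mv_D_D c : mv_D X n (mv_D X n c) = 0.
Proof.
apply/ffunP => tau; rewrite mv_DE [RHS]ffunE; case: eqP => // /eqP t0.
rewrite (@aug_D_local _ (aug_D c)) ?aug_D_D ?ffunE // => s s0.
by rewrite mv_DE (negPf s0).
Qed.

End Families.

(** * Contraction of the augmented rows *)

Section Homotopy.
Variables (F : fieldType) (X : cellComplex F) (n : nat) (j0 : X -> 'I_n).
Implicit Types (c : mv_space X n).

(* For each cell s the augmented horizontal complex restricted to s is the
   augmented chain complex of a simplex, and joining with the vertex j0 s
   contracts it. *)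
Definition cone c : mv_space X n :=
  [ffun sigma : {set 'I_n} => [ffun s => if j0 s \in sigma
     then removal_sign F sigma (j0 s) * (c (sigma :\ j0 s) s : F) else 0]].

Lemma coneE c sigma s : cone c sigma s = if j0 s \in sigma
  then removal_sign F sigma (j0 s) * (c (sigma :\ j0 s) s : F) else 0.
Proof. by rewrite !ffunE. Qed.

Lemma cone_homotopy c : aug_hor F X n (cone c) + cone (aug_hor F X n c) = c.
Proof.
apply/ffunP => tau; apply/ffunP => s; rewrite ffunE [LHS]ffunE coneE !aug_horE.
rewrite !sum_ffunE; set j1 := j0 s.
have [jt | jt] := ifPn; last first.
  (* If j1 is not in tau, the cone of [aug_hor c] vanishes at tau and only adding j1 contributes to
     the other term. *)
  rewrite (bigD1 j1) //= addr0 ffunE coneE -/j1 !inE eqxx /= setU1K //.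
  rewrite big1 ?addr0 => [|j /andP[jt' jj]].
    by rewrite [_ *: _]mulrA removal_sign_sq mul1r.
  by rewrite ffunE coneE -/j1 !inE eq_sym (negPf jj) (negPf jt) scaler0.
(* If j1 is in tau, removing j1 and adding it again returns c; each other index j gives two terms
   that cancel by [removal_signC]. *)
rewrite [X in _ * X](bigD1 j1) ?inE ?eqxx //= setD1K //.
rewrite ffunE mulrDr [_ *: _]/(_ * _) mulrA removal_sign_sq mul1r addrCA.
rewrite mulr_sumr [X in _ + (_ + X)](eq_bigl (fun j => j \notin tau)); last first.
  move=> j; rewrite !inE negb_and negbK.
  by have [->|] := eqVneq j j1; rewrite ?jt ?andbF //= andbT.
rewrite -big_split big1 ?addr0 // => j jnt /=.
have jj : j != j1 by apply: contraNneq jnt => ->.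
rewrite ffunE coneE [X in _ + _ * X]ffunE -/j1 !inE jt orbT /= ![_ *: _]/(_ * _).
have := @removal_signC F n (j |: tau) j j1.
rewrite !inE eqxx jt orbT => /(_ isT isT jj); rewrite setU1K //.
have -> : (j |: tau) :\ j1 = j |: tau :\ j1.
  by apply/setP => i; rewrite !inE; have [->|] := eqVneq i j; rewrite ?jj.
set a := removal_sign _ _ _; set b := removal_sign _ _ _.
set d := removal_sign _ _ _; set e := removal_sign _ _ _ => abde.
have dd : d * d = 1 := removal_sign_sq _ _ _ _.
have bb : b * b = 1 := removal_sign_sq _ _ _ _.
have ae : a = - (d * e) * b by rewrite -abde -mulrA bb mulr1.
transitivity ((a * d + b * e) * (c (j |: tau :\ j1) s : F)).
  by rewrite mulrDl -!mulrA.
suff -> : a * d + b * e = 0 by rewrite mul0r.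
transitivity (b * e * (1 - d * d)); first by rewrite ae; ring.
by rewrite dd subrr mulr0.
Qed.

End Homotopy.

Section AugmentedFamilies.
Variables (F : fieldType) (X : cellComplex F) (n : nat).
Variables (B : {set 'I_n} -> {set X}) (P : pred nat).
Hypothesis B_subcomplex : forall sigma, subcomplex (B sigma).
Hypothesis B_anti : forall (j : 'I_n) (tau : {set 'I_n}),
  j \notin tau -> B (j |: tau) \subset B tau.
Hypothesis P_down : forall m, P m.+1 -> P m.

(** A set sigma sits in column #|sigma| - 1, hence the chain degree for total degree k. [P] selects
    the columns kept: all of them for the exactness argument, those up to p for the stability of F_p
    under D. *)
Definition aug_chains (k : int) (sigma : {set 'I_n}) : {vspace total_chains X} :=
  if P #|sigma| then chains (B sigma) (k + 1 - #|sigma|%:Z) else 0%VS.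

Lemma aug_D_chains k c :
  c \in family_space F X n (aug_chains k) ->
  aug_D F X n c \in family_space F X n (aug_chains (k - 1)).
Proof.
move=> /mem_family_space cP; apply/mem_family_space => tau.
rewrite aug_DE aug_horE aug_verE; apply: memvD.
  apply: memv_suml => j jt; apply: memvZ; have := cP (j |: tau).
  rewrite /aug_chains cardsU1 jt /= add1n.
  case: ifP => [/P_down-> | _]; last by rewrite memv0 => /eqP->; apply: mem0v.
  have -> : k + 1 - (#|tau|.+1)%:Z = k - 1 + 1 - #|tau|%:Z by lia.
  by move=> cj; apply: subvP (chainsS _ _ _ _ _ _) _ cj; apply: B_anti.
apply: memvZ; have := cP tau; rewrite /aug_chains; case: ifP => _.
  have -> : k - 1 + 1 - #|tau|%:Z = k + 1 - #|tau|%:Z - 1 by ring.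
  exact: subcomplex_bd.
by rewrite memv0 => /eqP->; rewrite linear0 mem0v.
Qed.

End AugmentedFamilies.

(** * Shifted stages and exactness of the augmented complex *)

Section Stages.
Variables (F : fieldType) (X : cellComplex F) (n : nat) (Xf : filtration X n).
Variable u : 'rV[int]_n.
Implicit Types (sigma tau : {set 'I_n}) (p q k : int).

Definition shifted sigma : {set X} := Xf (u - unit_grade_set sigma).

Lemma unit_grade_setE sigma j : unit_grade_set sigma 0 j = (j \in sigma)%:R.
Proof.
rewrite /unit_grade_set summxE; have [js | js] := boolP (j \in sigma).
  rewrite (bigD1 j) //= big1 ?addr0 => [|i /andP[_ ij]].
    by rewrite mxE !eqxx.
  by rewrite mxE eqxx eq_sym (negPf ij).
rewrite big1 // => i si; rewrite mxE eqxx /=; case: eqP => // ij.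
by rewrite ij si in js.
Qed.

Lemma shifted0 : shifted set0 = Xf u.
Proof. by rewrite /shifted /unit_grade_set big_set0 subr0. Qed.

Lemma shifted1 j : shifted [set j] = Xf (u - unit_grade j).
Proof. by rewrite /shifted /unit_grade_set big_set1. Qed.

(** This is where one-criticality enters: the entry grade of a cell is below both shifted grades
    exactly when it is below their coordinatewise minimum, which is u - e_(sigma :|: tau). *)
Lemma shiftedU sigma tau : shifted (sigma :|: tau) = shifted sigma :&: shifted tau.
Proof.
have [f [_ fP]] := stage_one_critical Xf; rewrite /shifted !fP.
apply/setP => s; rewrite !inE; apply/forallP/andP => [h | [/forallP h1 /forallP h2] j].
  split; apply/forallP => j; move: (h j);
    rewrite !mxE /= !unit_grade_setE !inE; case: (_ \in _); case: (_ \in _) => /=; lia.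
move: (h1 j) (h2 j).
by rewrite !mxE /= !unit_grade_setE !inE; case: (_ \in _); case: (_ \in _) => /=; lia.
Qed.

Lemma shifted_bigcap sigma : sigma != set0 ->
  shifted sigma = \bigcap_(j in sigma) Xf (u - unit_grade j).
Proof.
move=> /set0Pn[i is_]; have [f [_ fP]] := stage_one_critical Xf.
apply/setP => s; apply/idP/bigcapP => [ss j js | h].
  by move: ss; rewrite -shifted1 -(setD1K js) shiftedU inE => /andP[].
rewrite /shifted fP inE; apply/forallP => j; rewrite !mxE unit_grade_setE.
have [js | js] := boolP (j \in sigma).
  by have := h j js; rewrite fP inE => /forallP/(_ j); rewrite !mxE !eqxx.
(* A coordinate outside sigma is bounded through some i in sigma, which exists because sigma is
   nonempty. *)
have := h i is_; rewrite fP inE => /forallP/(_ j); rewrite !mxE /= => h1.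
by apply: le_trans h1 _; case: (_ == _) => /=; lia.
Qed.

Lemma shifted_subcomplex sigma : subcomplex (shifted sigma).
Proof. exact: stage_subcomplex. Qed.

Lemma shifted_anti j tau : j \notin tau -> shifted (j |: tau) \subset shifted tau.
Proof. by move=> _; rewrite shiftedU subsetIr. Qed.

Definition shifted_cup : {set X} := \bigcup_(j < n) Xf (u - unit_grade j).

Lemma shifted_cup_subcomplex : subcomplex shifted_cup.
Proof. by apply: subcomplex_bigcup => j; apply: stage_subcomplex. Qed.

Lemma shifted_sub_cup sigma : sigma != set0 -> shifted sigma \subset shifted_cup.
Proof.
move=> /set0Pn[j js]; apply: subset_trans (bigcup_sup j _) => //.
by rewrite -shifted1 -(setD1K js) shiftedU subsetIl.
Qed.

Lemma shifted_cup_sub : shifted_cup \subset Xf u.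
Proof.
apply/bigcupsP => j _; rewrite -shifted1 -shifted0 -[[set j]]setU0.
by apply: shifted_anti; rewrite in_set0.
Qed.

(** The empty set carries the union A here, whereas [shifted set0] is X^u: the rows become exact
    with A, while the Koszul complex has X^u in degree 0. *)
Definition mv_base sigma := if sigma == set0 then shifted_cup else shifted sigma.

Lemma mv_base_subcomplex sigma : subcomplex (mv_base sigma).
Proof.
by rewrite /mv_base; case: ifP => _; [apply: shifted_cup_subcomplex | apply: shifted_subcomplex].
Qed.

Lemma set1U_neq0 j tau : j |: tau != set0.
Proof. by apply/set0Pn; exists j; rewrite !inE eqxx. Qed.

Lemma mv_base_anti j tau : j \notin tau -> mv_base (j |: tau) \subset mv_base tau.
Proof.
move=> jt; rewrite /mv_base (negPf (set1U_neq0 _ _)); case: ifP => _.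
  exact/shifted_sub_cup/set1U_neq0.
exact: shifted_anti.
Qed.

Lemma card_rem j sigma : j \in sigma -> #|sigma| = #|sigma :\ j|.+1.
Proof. by move=> js; rewrite (cardsD1 j) js. Qed.

Definition aug_mv k := family_space F X n (aug_chains F X n mv_base predT k).

(** Induction clearing the lowest nonzero column: subtracting the boundary of the cone of c moves
    the support to larger subsets, and there are no subsets with more than n elements. *)
Lemma aug_mv_exact_from (hn : (1 <= n)%N) m k c : c \in aug_mv k -> aug_D F X n c = 0 ->
  (forall sigma, (#|sigma| < n.+1 - m)%N -> c sigma = 0) ->
  exists2 c', c' \in aug_mv (k + 1) & aug_D F X n c' = c.
Proof.
elim: m c => [|m IHm] c cG Dc c0.
  exists 0; rewrite ?mem0v // linear0; apply/ffunP => sigma; rewrite ffunE c0 //.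
  by rewrite subn0 ltnS -[X in (_ <= X)%N]card_ord max_card.
(* Each cell of the union gets the index of some X_j containing it; the default value only serves
   cells outside the union. *)
pose j0 (s : X) := odflt (Ordinal hn) [pick j | s \in shifted [set j]].
have j0P s : s \in shifted_cup -> s \in shifted [set j0 s].
  move=> /bigcupP[j _]; rewrite -shifted1 => sj; rewrite /j0.
  by case: pickP => [//|/(_ j)]; rewrite sj.
pose w := cone F X n j0 c.
have wG : w \in aug_mv (k + 1).
  apply/mem_family_space => sigma; rewrite /aug_chains /=; apply/mem_chains => s.
  rewrite coneE; case: ifP => [js|]; last by rewrite eqxx.
  rewrite mulf_eq0 negb_or => /andP[_ cs].
  move/mem_family_space/(_ (sigma :\ j0 s)): cG; rewrite /aug_chains /= => /mem_chains/(_ s cs).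
  rewrite (card_rem _ _ js) => -[sB ->].
  split; last by rewrite intS; ring.
  have sA : s \in shifted_cup.
    move: sB; rewrite /mv_base; case: eqP => // /eqP s0.
    exact/subsetP/shifted_sub_cup.
  (* A cell lying in the base of sigma minus j0 s and in the X_j of index j0 s lies in their
     intersection, the base of sigma. *)
  have {}j0s := j0P _ sA; rewrite -(setD1K js) /mv_base (negPf (set1U_neq0 _ _)).
  rewrite shiftedU inE j0s; move: sB; rewrite /mv_base; case: eqP => // -> _.
  by rewrite shifted0; apply: subsetP sA; apply: shifted_cup_sub.
have [||sigma ss|c' c'G c'D] := IHm (c - aug_D F X n w).
- rewrite memvB // -[k](addrK 1).
  by apply: aug_D_chains wG => //; [apply: mv_base_subcomplex | apply: mv_base_anti].
- by rewrite linearB /= Dc aug_D_D subrr.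
(* By the homotopy formula the remainder is made of [cone (aug_hor c)] and [aug_ver w]. As c is a
   cycle, [aug_hor c] is minus [aug_ver c], so both pieces start one column after c. *)
- have cD : c - aug_D F X n w = cone F X n j0 (aug_hor F X n c) - aug_ver F X n w.
    rewrite -{1}(cone_homotopy F X n j0 c) add_lfunE -/w opprD addrA.
    by congr (_ - _); rewrite addrC addrA addNr add0r.
  have subE (a b : mv_space X n) rho s : (a - b) rho s = a rho s - b rho s.
    by rewrite !ffunE.
  rewrite cD; apply/ffunP => s; rewrite subE coneE aug_verE.
  have w0 tau : (#|tau| < n.+1 - m)%N -> w tau = 0.
    move=> tm; apply/ffunP => t; rewrite coneE ffunE; case: ifP => // jt.
    by rewrite c0 ?ffunE ?mulr0 //; move: tm; rewrite (card_rem _ _ jt) subSS !ltn_subRL addnS ltnS.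
  rewrite w0 // linear0 scaler0 [X in _ - X]ffunE subr0 [RHS]ffunE; case: ifP => // js.
  have hc : aug_hor F X n c = - aug_ver F X n c.
    by apply/eqP; rewrite -subr_eq0 opprK -add_lfunE; apply/eqP.
  rewrite hc ffunE aug_verE c0 ?linear0 ?scaler0 ?oppr0 ?ffunE ?mulr0 //.
  by move: ss; rewrite (card_rem _ _ js) subSS !ltn_subRL addnS ltnS.
exists (c' + w); first by rewrite memvD.
by rewrite linearD /= c'D subrK.
Qed.

Lemma aug_mv_exact (hn : (1 <= n)%N) k c : c \in aug_mv k -> aug_D F X n c = 0 ->
  exists2 c', c' \in aug_mv (k + 1) & aug_D F X n c' = c.
Proof.
by move=> cG Dc; apply: (@aug_mv_exact_from hn n.+1) => // sigma; rewrite subnn.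
Qed.

End Stages.

(** * The first page *)

Section Columns.
Variables (F : fieldType) (X : cellComplex F) (n : nat).
Implicit Types (c : mv_space X n) (sigma tau : {set 'I_n}) (i : nat).
Implicit Types (W : {set 'I_n} -> {vspace total_chains X}).

(** The index is the size of the subsets: Koszul degree i, and Mayer-Vietoris column i - 1. *)
Definition column i W : {vspace mv_space X n} :=
  family_space F X n (fun sigma => if #|sigma| == i then W sigma else 0%VS).

Lemma mem_column i W c :
  reflect (forall sigma, if #|sigma| == i then is_true (c sigma \in W sigma) else c sigma = 0)
    (c \in column i W).
Proof.
apply: (iffP (mem_family_space _ _ _ _ _)) => h sigma; have := h sigma; case: ifP => //.
  by rewrite memv0 => _ /eqP.
by move=> _ ->; apply: mem0v.
Qed.

Lemma columnS i W W' : (forall sigma, (W sigma <= W' sigma)%VS) ->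
  (column i W <= column i W')%VS.
Proof.
move=> WW'; apply/subvP => c /mem_column cP; apply/mem_column => sigma.
by have := cP sigma; case: ifP => // _; apply: subvP.
Qed.

Lemma aug_hor_column i W :
  (forall (j : 'I_n) tau, j \notin tau -> (W (j |: tau) <= W tau)%VS) ->
  (aug_hor F X n @: column i.+1 W <= column i W)%VS.
Proof.
move=> Wanti; apply/subvP => _ /memv_imgP[c /mem_column cP ->].
apply/mem_column => tau; rewrite aug_horE; case: ifP => ti.
  apply: memv_suml => j jt; apply: memvZ; have := cP (j |: tau).
  by rewrite cardsU1 jt add1n eqSS ti; apply: subvP; apply: Wanti.
rewrite big1 // => j jt; have := cP (j |: tau).
by rewrite cardsU1 jt add1n eqSS ti => ->; rewrite scaler0.
Qed.

Lemma aug_ver_column i W :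
  (aug_ver F X n @: column i W = column i (fun sigma => bd X @: W sigma)%VS)%VS.
Proof.
apply/eqP; rewrite eqEsubv; apply/andP; split.
  apply/subvP => _ /memv_imgP[c /mem_column cP ->].
  apply/mem_column => tau; rewrite aug_verE; have := cP tau; case: ifP => _ ct.
    by apply: memvZ; apply: memv_img.
  by rewrite ct linear0 scaler0.
apply/subv_sumP => sigma _; case: ifP => si; last by rewrite limg0 sub0v.
apply/subvP => _ /memv_imgP[_ /memv_imgP[x xW ->] ->].
pose y : mv_space X n := mv_inj X sigma ((-1) ^+ #|sigma|.+1 *: x).
have -> : mv_inj X sigma (bd X x) = aug_ver F X n y.
  apply/ffunP => tau; rewrite aug_verE /y !mv_injE; case: eqP => [->|_].
    by rewrite linearZ /= scalerA -expr2 sqrr_sign scale1r.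
  by rewrite linear0 scaler0.
apply: memv_img; apply/mem_column => tau; rewrite mv_injE.
case: (eqVneq tau sigma) => [->|_]; first by rewrite si memvZ.
by case: ifP => // _; apply: mem0v.
Qed.

End Columns.

(** * The column filtration and the pages it determines *)

Section MayerVietorisFiltration.
Variables (F : fieldType) (X : cellComplex F) (n : nat) (Xf : filtration X n).
Variable u : 'rV[int]_n.
Implicit Types (c : mv_space X n) (sigma tau : {set 'I_n}) (i : nat) (p q k : int).
Local Notation Y := (shifted F X n Xf u).
Local Notation Fil := (mv_filt Xf u).
Local Notation D := (mv_D X n).
Local Notation hor := (aug_hor F X n).
Local Notation ver := (aug_ver F X n).

Definition filt_family p k sigma : {vspace total_chains X} :=
  if (0 < #|sigma|)%N && (#|sigma|%:Z <= p + 1)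
  then chains (Y sigma) (k + 1 - #|sigma|%:Z) else 0%VS.

Lemma mv_filtE p k : Fil p k = family_space F X n (filt_family p k).
Proof.
apply/eqP; rewrite eqEsubv; apply/andP; split.
  apply/subv_sumP => i ip; rewrite /mv_C le0z_nat; apply/subv_sumP => sigma /eqP si.
  apply: (sumv_sup sigma) => //; apply: limgS.
  have s0 : (0 < #|sigma|)%N by lia.
  rewrite /filt_family s0 shifted_bigcap -?card_gt0 // ifT; last by lia.
  by have -> : k + 1 - #|sigma|%:Z = k - i%:Z by lia.
apply/subv_sumP => sigma _; rewrite /filt_family; case: ifP => [/andP[s0 sp]|_]; last first.
  by rewrite limg0 sub0v.
have sn : (#|sigma|.-1 < n)%N by rewrite prednK // -[X in (_ <= X)%N]card_ord max_card.
have s1 : #|sigma|%:Z = #|sigma|.-1%:Z + 1 by lia.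
apply: (sumv_sup (Ordinal sn)); first by rewrite /= -(lerD2r 1) -s1.
rewrite /mv_C le0z_nat; apply: (sumv_sup sigma); first by apply/eqP.
rewrite shifted_bigcap -?card_gt0 //; apply: limgS.
by have -> : k + 1 - #|sigma|%:Z = k - #|sigma|.-1%:Z by lia.
Qed.

Lemma mem_mv_filt p k c :
  reflect (forall sigma, c sigma \in filt_family p k sigma) (c \in Fil p k).
Proof. by rewrite mv_filtE; apply: mem_family_space. Qed.

Lemma mv_filt_mono p p' k : p <= p' -> (Fil p k <= Fil p' k)%VS.
Proof.
move=> pp; apply/subvP => c /mem_mv_filt cP; apply/mem_mv_filt => sigma.
have := cP sigma; rewrite /filt_family; case: ifP => [/andP[-> sp]|_].
  by rewrite ifT //= (le_trans sp) // lerD2r.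
by rewrite memv0 => /eqP->; apply: mem0v.
Qed.

Lemma mv_filt_D p k : (D @: Fil p k <= Fil p (k - 1))%VS.
Proof.
apply/subvP => _ /memv_imgP[c /mem_mv_filt cP ->]; apply/mem_mv_filt => sigma.
rewrite mv_DE /filt_family; case: eqP => [->|/eqP s0]; first exact: mem0v.
rewrite card_gt0 s0 /=.
(* F_p is, at nonempty sets, the augmented complex truncated to sets of size at most p + 1, which is
   closed under removing elements. *)
pose P (m : nat) := m%:Z <= p + 1.
suff /mem_family_space/(_ sigma) :
  aug_D F X n c \in family_space F X n (aug_chains F X n Y P (k - 1)) by [].
apply: aug_D_chains.
- exact: shifted_subcomplex.
- exact: shifted_anti.
- by rewrite /P => m; lia.
apply/mem_family_space => tau; rewrite /aug_chains; have := cP tau; rewrite /filt_family /P.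
case: (_ <= p + 1); rewrite ?andbF // andbT; case: ifP => // _.
by rewrite memv0 => /eqP->; apply: mem0v.
Qed.

Lemma mv_filt_lt0 p k : p < 0 -> Fil p k = 0%VS.
Proof.
move=> p0; apply/eqP; rewrite -subv0; apply/subvP => c /mem_mv_filt cP.
rewrite memv0; apply/eqP/ffunP => sigma; have := cP sigma.
rewrite /filt_family ifF ?memv0 ?[RHS]ffunE => [/eqP-> //|]; lia.
Qed.

Lemma mv_filt_ge p k : n%:Z - 1 <= p -> Fil p k = Fil (n%:Z - 1) k.
Proof.
move=> np; rewrite /mv_filt; apply: eq_bigl => i; have := ltn_ord i; lia.
Qed.

Definition chain_column i q := column F X n i (fun sigma => chains (Y sigma) q).
Definition cycle_column i q := column F X n i (fun sigma => cycles (Y sigma) q).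
Definition boundary_column i q := column F X n i (fun sigma => boundaries (Y sigma) q).

Lemma ver_chain_column i q : (ver @: chain_column i (q + 1) = boundary_column i q)%VS.
Proof. exact: aug_ver_column. Qed.

Lemma ver_cycle c i q : c \in cycle_column i q -> ver c = 0.
Proof.
move=> /mem_column cP; apply/ffunP => sigma; rewrite aug_verE [RHS]ffunE.
have := cP sigma; case: ifP => [_ | _ ->]; last by rewrite linear0 scaler0.
by rewrite memv_cap memv_ker => /andP[_ /eqP->]; rewrite scaler0.
Qed.

Lemma chain_column_ker i q : (chain_column i q :&: lker ver = cycle_column i q)%VS.
Proof.
apply/eqP; rewrite eqEsubv; apply/andP; split; last first.
  rewrite subv_cap columnS => [|sigma]; last exact: capvSl.
  by apply/subvP => c /ver_cycle c0; rewrite memv_ker c0.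
apply/subvP => c; rewrite memv_cap memv_ker => /andP[/mem_column cP /eqP vc].
apply/mem_column => sigma; have := cP sigma; case: ifP => // _ cs.
rewrite memv_cap cs memv_ker /=.
have /ffunP/(_ sigma) := vc; rewrite aug_verE [RHS]ffunE => /eqP.
by rewrite scaler_eq0 signr_eq0.
Qed.

Lemma dim_chain_column i q :
  (\dim (cycle_column i (q + 1)) + \dim (boundary_column i q) =
   \dim (chain_column i (q + 1)))%N.
Proof. by rewrite -ver_chain_column -chain_column_ker limg_ker_dim. Qed.

Lemma boundary_column_sub i q : (boundary_column i q <= cycle_column i q)%VS.
Proof. by apply: columnS => sigma; apply/boundaries_sub_cycles/shifted_subcomplex. Qed.

Lemma hor_cycle_column i q : (hor @: cycle_column i.+1 q <= cycle_column i q)%VS.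
Proof. by apply: aug_hor_column => j tau jt; apply/cyclesS/shifted_anti. Qed.

Lemma hor_chain_column i q : (hor @: chain_column i.+1 q <= chain_column i q)%VS.
Proof. by apply: aug_hor_column => j tau jt; apply/chainsS/shifted_anti. Qed.

Lemma column_cap_filt i W k : (column F X n i.+1 W :&: Fil (i%:Z - 1) k = 0)%VS.
Proof.
apply/eqP; rewrite -subv0; apply/subvP => c.
rewrite memv_cap => /andP[/mem_column cW /mem_mv_filt cF].
rewrite memv0; apply/eqP/ffunP => sigma; rewrite [RHS]ffunE.
have := cW sigma; case: ifP => // /eqP si _; have := cF sigma.
by rewrite /filt_family si ifF ?memv0 => [/eqP //|]; lia.
Qed.

Lemma chain_column_filt i k : (chain_column i.+1 (k - i%:Z) <= Fil i%:Z k)%VS.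
Proof.
apply/subvP => c /mem_column cP; apply/mem_mv_filt => sigma.
have := cP sigma; case: ifP => [/eqP si|_ ->]; last by rewrite mem0v.
rewrite /filt_family si /= ifT; last by lia.
by have -> : k + 1 - (i.+1)%:Z = k - i%:Z by lia.
Qed.

Lemma mv_filt_split i k :
  Fil i%:Z k = (chain_column i.+1 (k - i%:Z) + Fil (i%:Z - 1) k)%VS.
Proof.
apply/eqP; rewrite eqEsubv; apply/andP; split; last first.
  by rewrite subv_add chain_column_filt mv_filt_mono //; lia.
apply/subvP => c /mem_mv_filt cP.
pose y : mv_space X n := [ffun sigma : {set 'I_n} => if #|sigma| == i.+1 then c sigma else 0].
rewrite -[c](subrKC y) memv_add //.
  apply/mem_column => sigma; have [si|si] := eqVneq #|sigma| i.+1; last first.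
    by rewrite ffunE (negPf si).
  rewrite ffunE si eqxx; have := cP sigma; rewrite /filt_family si /= ifT; last by lia.
  by have -> : k + 1 - (i.+1)%:Z = k - i%:Z by lia.
apply/mem_mv_filt => sigma.
have -> : (c - y) sigma = if #|sigma| == i.+1 then 0 else c sigma.
  by rewrite !ffunE; case: ifP => _; rewrite ?subrr ?subr0.
case: ifP => [_|/eqP si]; first exact: mem0v.
have := cP sigma; rewrite /filt_family.
suff -> : (0 < #|sigma|)%N && (#|sigma|%:Z <= i%:Z + 1) =
          (0 < #|sigma|)%N && (#|sigma|%:Z <= i%:Z - 1 + 1) by [].
by congr (_ && _); lia.
Qed.

Lemma D_chain_column i q c : c \in chain_column i.+2 q -> D c = hor c + ver c.
Proof.
move=> cC; rewrite -add_lfunE; apply/ffunP => sigma; rewrite mv_DE -/(aug_D F X n).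
case: eqP => // ->; rewrite aug_DE.
have /mem_column/(_ set0) := subvP (hor_chain_column _ _) _ (memv_img hor cC).
rewrite cards0 /= => ->; move/mem_column/(_ set0): cC.
by rewrite aug_verE cards0 /= => ->; rewrite linear0 scaler0 addr0.
Qed.

(** Modulo F_(p-1) the total differential on column p is the vertical one, since the horizontal part
    lowers the column. *)
Lemma hor_D_chain_column i q c :
  c \in chain_column i.+1 q -> D c - ver c \in Fil (i%:Z - 1) (q + i%:Z - 1).
Proof.
(* From column 0 the horizontal part only reaches the augmentation column, which [mv_D] discards. *)
case: i => [|i] cC.
  rewrite mv_filt_lt0 // memv0; apply/eqP/ffunP => sigma.
  have subE (a b : mv_space X n) : (a - b) sigma = a sigma - b sigma by rewrite !ffunE.
  rewrite subE mv_DE [RHS]ffunE; case: eqP => [->|/eqP s0].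
    move/mem_column/(_ set0): cC; rewrite cards0 /= aug_verE => ->.
    by rewrite linear0 scaler0 subr0.
  have /mem_column/(_ sigma) := subvP (hor_chain_column _ _) _ (memv_img hor cC).
  by rewrite cards_eq0 (negPf s0) aug_DE => ->; rewrite add0r subrr.
rewrite (D_chain_column i q) // addrK.
have -> : i.+1%:Z - 1 = i%:Z by lia.
apply: subvP (chain_column_filt i _) _ _.
have -> : q + i.+1%:Z - 1 - i%:Z = q by lia.
exact: subvP (hor_chain_column _ _) _ (memv_img hor cC).
Qed.

Local Notation fZ := (fil_Z F (mv_space X n) D Fil).
Local Notation fB := (fil_B F (mv_space X n) D Fil).

Lemma mv_Z0 p k : fZ 0 p k = Fil p k.
Proof.
apply/vspaceP => x; rewrite mem_fil_Z subr0; case: (boolP (x \in _)) => //= xF.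
exact: subvP (mv_filt_D _ _) _ (memv_img _ xF).
Qed.

Lemma mv_Z1 i k : fZ 1 i%:Z k = (cycle_column i.+1 (k - i%:Z) + Fil (i%:Z - 1) k)%VS.
Proof.
have qk : k - i%:Z + i%:Z - 1 = k - 1 by ring.
apply/eqP; rewrite eqEsubv; apply/andP; split.
  apply/subvP => x; rewrite mem_fil_Z mv_filt_split => /andP[].
  move=> /memv_addP[c cC [y yF ->]] Dx; rewrite memv_add //.
  (* The vertical boundary of c lies both in column i and in F_(i-1), hence is zero. *)
  rewrite -chain_column_ker memv_cap cC memv_ker -memv0.
  rewrite -(column_cap_filt i (fun sigma => bd X @: chains (Y sigma) (k - i%:Z))%VS (k - 1)).
  rewrite memv_cap -aug_ver_column memv_img //=.
  have := hor_D_chain_column _ _ _ cC; rewrite qk => h.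
  have Dy := subvP (mv_filt_D _ _) _ (memv_img D yF).
  have -> : ver c = D (c + y) - D y - (D c - ver c).
    by rewrite linearD /= addrK subKr.
  exact: memvB (memvB Dx Dy) h.
rewrite subv_add; apply/andP; split; apply/subvP => c cZ; rewrite mem_fil_Z.
  have cC : c \in chain_column i.+1 (k - i%:Z).
    by move: cZ; rewrite -chain_column_ker memv_cap => /andP[].
  rewrite (subvP (chain_column_filt _ _) _ cC) /=.
  by have := hor_D_chain_column _ _ _ cC; rewrite qk (ver_cycle _ _ _ cZ) subr0.
rewrite (subvP (mv_filt_mono _ _ _ _) _ cZ) ?(subvP (mv_filt_D _ _) _ (memv_img D cZ)) //; lia.
Qed.

Lemma mv_B1 i k : fB 1 i%:Z k = (boundary_column i.+1 (k - i%:Z) + Fil (i%:Z - 1) k)%VS.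
Proof.
rewrite /fil_B subrr !mv_Z0 addrK.
have qk : k + 1 - i%:Z = k - i%:Z + 1 by ring.
have qk' : k - i%:Z + 1 + i%:Z - 1 = k by ring.
apply/eqP; rewrite eqEsubv; apply/andP; split; rewrite subv_add addvSr andbT.
  apply/subvP => _ /memv_imgP[x xF ->].
  move: xF; rewrite mv_filt_split => /memv_addP[c cC [y yF ->]].
  move: cC; rewrite qk => cC.
  have -> : D (c + y) = ver c + (D c - ver c + D y).
    by rewrite linearD /= addrA subrKC.
  rewrite -ver_chain_column memv_add ?memv_img // memvD //.
    by have := hor_D_chain_column _ _ _ cC; rewrite qk'.
  by have := subvP (mv_filt_D _ _) _ (memv_img D yF); rewrite addrK.
apply/subvP => x; rewrite -ver_chain_column => /memv_imgP[c cC ->].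
have -> : ver c = D c - (D c - ver c) by rewrite subKr.
rewrite memv_add ?memvN //; last by have := hor_D_chain_column _ _ _ cC; rewrite qk'.
by apply/memv_img/(subvP (chain_column_filt _ _)); rewrite qk.
Qed.

Local Notation dE := (dimE F (mv_space X n) D Fil).
Local Notation dR := (rank_fil F (mv_space X n) D Fil).

Lemma mv_dimE1 i k : dE 1 i%:Z k = (\dim (cycle_column i.+1 (k - i%:Z)))%:Z
  - (\dim (boundary_column i.+1 (k - i%:Z)))%:Z.
Proof.
rewrite /dimE subrr addrK /dimZ !mv_Z0 !mv_Z1 mv_filt_split.
rewrite !dimv_disjoint_sum ?column_cap_filt //.
have -> : k + 1 - i%:Z = k - i%:Z + 1 by ring.
have := dim_chain_column i.+1 (k - i%:Z); lia.
Qed.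

(** The first differential is induced by the horizontal map on vertical homology; the common summand
    F_(i-1) cancels from both sides. *)
Lemma mv_rank1 i k : let q := k - i.+1%:Z in
  (\dim (hor @: cycle_column i.+2 q + boundary_column i.+1 q))%:Z =
  dR 1 i.+1%:Z k + (\dim (boundary_column i.+1 q))%:Z.
Proof.
move=> q.
have := dim_limg_fil _ _ _ _ (mv_D_D F X n) mv_filt_mono 1 i.+1%:Z k.
have -> : i.+1%:Z - 1 = i%:Z by lia.
rewrite mv_B1 mv_Z1.
have -> : i.+1%:Z - 1 = i%:Z by lia.
have -> : k - 1 - i%:Z = q by rewrite /q; lia.
have -> : (D @: (cycle_column i.+2 (k - i.+1%:Z) + Fil i%:Z k) +
    (boundary_column i.+1 q + Fil (i%:Z - 1) (k - 1)) =
    hor @: cycle_column i.+2 q + boundary_column i.+1 q + Fil (i%:Z - 1) (k - 1))%VS.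
  rewrite limgD -/q -!addvA.
  have -> : (D @: cycle_column i.+2 q = hor @: cycle_column i.+2 q)%VS.
    apply: eq_in_limg => c cZ; rewrite (D_chain_column i q); last first.
      by move: cZ; rewrite -chain_column_ker memv_cap => /andP[].
    by rewrite (ver_cycle _ _ _ cZ) addr0.
  (* The image under D of F_i is absorbed, being one of the two summands of B^1. *)
  congr (_ + _)%VS; apply/addv_idPr.
  have := mv_B1 i (k - 1); have -> : k - 1 - i%:Z = q by rewrite /q; lia.
  by move=> <-; rewrite /fil_B subrr !mv_Z0 addrK subrK addvSl.
have dis W : (W <= cycle_column i.+1 q)%VS ->
    \dim (W + Fil (i%:Z - 1) (k - 1)) = (\dim W + \dim (Fil (i%:Z - 1) (k - 1)))%N.
  move=> WZ; apply: dimv_disjoint_sum; apply/eqP; rewrite -subv0.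
  rewrite -(column_cap_filt i (fun sigma => cycles (Y sigma) q) (k - 1)).
  exact: capvS.
rewrite !dis ?subv_add ?boundary_column_sub ?hor_cycle_column //; lia.
Qed.

Lemma mv_filt0_ker k : (Fil 0 k :&: lker D = cycle_column 1 k)%VS.
Proof.
have := mv_Z1 0 k; rewrite mv_filt_lt0 // addv0 subr0 => <-.
by rewrite /fil_Z (mv_filt_lt0 (0 - 1)) // lpreim0.
Qed.

(** A differential leaving column 0 lands in a negative column. *)
Lemma mv_rank0 r k : 0 < r -> dR r 0 k = 0.
Proof.
move=> r0; rewrite /rank_fil /dimZ /fil_Z.
have -> : 0 - 1 - (r - 1) = - r by ring.
by rewrite !(mv_filt_lt0 (0 - _)) ?(mv_filt_lt0 (- r)) ?cap0v ?dimv0 ?subrr; try lia.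
Qed.

End MayerVietorisFiltration.

(** * The Koszul complex *)

Lemma lfun_sumZ (F : fieldType) (U V : vectType F) (f : 'Hom(U, V)) (I : finType)
    (P : pred I) (a : I -> F) (x : I -> U) :
  f (\sum_(i | P i) a i *: x i) = \sum_(i | P i) a i *: f (x i).
Proof. by rewrite linear_sum; apply: eq_bigr => i _; rewrite linearZ. Qed.

Section Koszul.
Variables (F : fieldType) (X : cellComplex F) (n : nat) (Xf : filtration X n).
Variable u : 'rV[int]_n.
Implicit Types (c : mv_space X n) (sigma tau : {set 'I_n}) (i : nat) (a b q : int).
Local Notation Y := (shifted F X n Xf u).
Local Notation hor := (aug_hor F X n).
Local Notation ZZ := (cycle_column F X n Xf u).
Local Notation BB := (boundary_column F X n Xf u).

(** Presents the Koszul term as cycle columns modulo boundary columns. The integer degree [a] is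
    kept apart from the natural column index i, because [betti] involves the degrees i + 1 and i -
    1. *)
Definition koszul_cls a q : 'Hom(mv_space X n, koszul Xf u a q) :=
  linfun (fun c : mv_space X n => mkdsum (fun sigma : subsets_of_size n a =>
    cls (cycles (Y (val sigma)) q) (boundaries (Y (val sigma)) q) (c (val sigma)))
  : koszul Xf u a q).

Lemma koszul_clsE a q c (sigma : subsets_of_size n a) : koszul_cls a q c sigma =
  cls (cycles (Y (val sigma)) q) (boundaries (Y (val sigma)) q) (c (val sigma)).
Proof.
rewrite linfun_linearE => [|r x y]; first by rewrite mkdsumE.
by apply: dsumP => s; rewrite !mkdsumE linearP.
Qed.

Lemma koszul_cls_ker a q i c : a = i%:Z -> c \in ZZ i q ->
  (koszul_cls a q c == 0) = (c \in BB i q).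
Proof.
move=> ai /mem_column cZ; apply/eqP/mem_column => [c0 sigma | cB].
  have := cZ sigma; case: ifP => // si cs.
  have sa : #|sigma|%:Z == a by rewrite ai eqz_nat.
  have [s e] : exists s : subsets_of_size n a, val s = sigma by exists (Sub sigma sa).
  rewrite -e in cs *; rewrite -(cls_eq0 _ cs); apply/eqP.
  by rewrite -koszul_clsE c0 mkdsumE.
apply: dsumP => sigma; rewrite koszul_clsE mkdsumE.
have si : #|val sigma| == i by rewrite -eqz_nat -ai (valP sigma).
have := cB (val sigma); have := cZ (val sigma); rewrite si => cs cb.
by apply/eqP; rewrite cls_eq0.
Qed.

Lemma limg_koszul_cls a q i : a = i%:Z -> (koszul_cls a q @: ZZ i q)%VS = fullv.
Proof.
move=> ai; apply/eqP; rewrite eqEsubv subvf /=; apply/subvP => x _.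
pose y : mv_space X n := [ffun sigma : {set 'I_n} =>
  (if insub sigma is Some s then rep (x (s : subsets_of_size n a)) else 0) : total_chains X].
have yE s : y (val s) = rep (x (s : subsets_of_size n a)) by rewrite ffunE valK.
have -> : x = koszul_cls a q y.
  by apply: dsumP => s; rewrite koszul_clsE yE cls_rep.
apply: memv_img; apply/mem_column => sigma; rewrite ffunE.
case: insubP => [s sa <-|]; last by rewrite ai eqz_nat => /negPf->.
by rewrite -eqz_nat -ai (valP s) rep_mem.
Qed.

Lemma dim_limg_koszul_cls a q i (U : {vspace mv_space X n}) : a = i%:Z ->
  (U <= ZZ i q)%VS -> (\dim (koszul_cls a q @: U) + \dim (BB i q) = \dim (U + BB i q))%N.
Proof.
move=> ai UZ; have := limg_ker_dim (koszul_cls a q) U; have := dimv_sum_cap U (BB i q).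
suff -> : (U :&: lker (koszul_cls a q) = U :&: BB i q)%VS by lia.
apply/vspaceP => x; rewrite !memv_cap; apply: andb_id2l => xU.
by rewrite memv_ker (koszul_cls_ker _ _ i) //; apply: subvP xU.
Qed.

Lemma dim_koszul a q i : a = i%:Z ->
  (\dim {: koszul Xf u a q} + \dim (BB i q) = \dim (ZZ i q))%N.
Proof.
move=> ai; rewrite -(limg_koszul_cls a q i) // dim_limg_koszul_cls //.
by rewrite (addv_idPl (boundary_column_sub _ _ _ _ _ _ _)).
Qed.

Lemma koszul_lt0 a q (x : koszul Xf u a q) : a < 0 -> x = 0.
Proof. by move=> a0; apply: dsumP => s; have := valP s; move: a0; case: a x s => //. Qed.

Lemma koszul_dE q a b (x : koszul Xf u a q) (tau : subsets_of_size n b) :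
  koszul_d Xf u q a b x tau = \sum_(sigma : subsets_of_size n a)
    \sum_(j in val sigma | val sigma :\ j == val tau)
      removal_sign F (val sigma) j *: cell_H_incl (Y (val sigma)) (Y (val tau)) q (x sigma).
Proof.
rewrite linfun_linearE => [|r y z]; first by rewrite mkdsumE.
apply: dsumP => t; rewrite !mkdsumE scaler_sumr -big_split; apply: eq_bigr => s _ /=.
rewrite scaler_sumr -big_split; apply: eq_bigr => j _ /=.
by rewrite !mkdsumE linearP scalerDr !scalerA mulrC.
Qed.

(** On representatives the Koszul differential is the augmented horizontal map: both run over the
    removals of one element with the same sign. *)
Lemma koszul_d_cls q a b i c : a = i.+1%:Z -> b = i%:Z -> c \in ZZ i.+1 q ->
  koszul_d Xf u q a b (koszul_cls a q c) = koszul_cls b q (hor c).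
Proof.
move=> ai bi /mem_column cZ; apply: dsumP => tau; rewrite koszul_dE koszul_clsE.
set ct := cls _ _.
transitivity (\sum_(sigma : subsets_of_size n a)
    \sum_(j in val sigma | val sigma :\ j == val tau)
      removal_sign F (val sigma) j *: ct (c (val sigma))).
  apply: eq_bigr => sigma _; apply: eq_bigr => j /andP[js /eqP st]; congr (_ *: _).
  have sub : Y (val sigma) \subset Y (val tau).
    by rewrite -st -[X in Y X \subset _](setD1K js) shifted_anti // !inE eqxx.
  have si : #|val sigma| == i.+1 by rewrite -eqz_nat -ai (valP sigma).
  rewrite koszul_clsE /cell_H_incl quot_map_cls ?id_lfunE //.
  - by rewrite lim1g; exact: cyclesS.
  - by rewrite lim1g; exact: boundariesS.
  by have := cZ (val sigma); rewrite si.
rewrite aug_horE lfun_sumZ (exchange_big_dep xpredT) //= [RHS]big_mkcond.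
apply: eq_bigr => j _; have ti : #|val tau| = i.
  by apply/eqP; rewrite -eqz_nat -bi (valP tau).
case: ifPn => jt; last first.
  rewrite big1 // => s /andP[js /eqP e]; case/negP: jt.
  by rewrite -e !inE eqxx.
have sa : #|j |: val tau|%:Z == a by rewrite cardsU1 jt ti ai.
rewrite (bigD1 (Sub (j |: val tau) sa : subsets_of_size n a)) /=; last first.
  by rewrite !inE eqxx setU1K //= eqxx.
rewrite big1 ?addr0 // => s /andP[/andP[js /eqP e]].
case/eqP; apply: val_inj; rewrite SubK.
by rewrite -e setD1K.
Qed.

Lemma dim_limg_koszul_d q a b i : a = i.+1%:Z -> b = i%:Z ->
  (\dim (limg (koszul_d Xf u q a b)) + \dim (BB i q) =
   \dim (hor @: ZZ i.+1 q + BB i q))%N.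
Proof.
move=> ai bi; rewrite -(dim_limg_koszul_cls b q i) ?hor_cycle_column //.
rewrite -(limg_koszul_cls a q i.+1) // -!limg_comp; congr (\dim _ + _)%N.
by apply: eq_in_limg => c cZ; rewrite !comp_lfunE (koszul_d_cls _ _ _ i).
Qed.

Lemma koszul_d_d q i : (limg (koszul_d Xf u q (i%:Z + 1) i%:Z) <=
  lker (koszul_d Xf u q i%:Z (i%:Z - 1)))%VS.
Proof.
apply/subvP => _ /memv_imgP[x _ ->]; rewrite memv_ker; apply/eqP.
have := memvf x; rewrite -(limg_koszul_cls (i%:Z + 1) q i.+1); last by lia.
move=> /memv_imgP[c cZ ->{x}]; rewrite (koszul_d_cls q _ _ i) //; last by lia.
(* For i = 0 the target has degree -1, where there are no subsets. *)
case: i cZ => [|i] cZ.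
  exact: koszul_lt0.
rewrite (koszul_d_cls q _ _ i) //; last 2 [by lia].
  by rewrite aug_hor_hor linear0.
exact: subvP (hor_cycle_column _ _ _ _ _ _ _) _ (memv_img hor cZ).
Qed.

(** By [dim_limg_koszul_d] this is the rank of the Koszul differential from degree i + 1 to degree
    i. *)
Definition koszul_rank i q : int :=
  (\dim (hor @: ZZ i.+1 q + BB i q))%:Z - (\dim (BB i q))%:Z.

Lemma betti_succ i q : (betti Xf u i.+1%:Z q)%:Z =
  (\dim (ZZ i.+1 q))%:Z - (\dim (BB i.+1 q))%:Z - koszul_rank i.+1 q - koszul_rank i q.
Proof.
have := dim_homology _ _ _ _ _ _ (koszul_d_d q i.+1).
have := dim_limg_koszul_d q (i.+1%:Z + 1) i.+1%:Z i.+1.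
have := dim_limg_koszul_d q i.+1%:Z (i.+1%:Z - 1) i.
have := dim_koszul i.+1%:Z q i.+1 erefl.
rewrite /betti /koszul_rank.
move=> h1 h2 h3.
have {}h2 := h2 erefl ltac:(lia); have {}h3 := h3 ltac:(lia) erefl.
lia.
Qed.

Lemma betti0 q : (betti Xf u 0%:Z q)%:Z =
  (\dim (ZZ 0 q))%:Z - (\dim (BB 0 q))%:Z - koszul_rank 0 q.
Proof.
have := dim_homology _ _ _ _ _ _ (koszul_d_d q 0).
have := dim_limg_koszul_d q (0%:Z + 1) 0%:Z 0.
have := dim_koszul 0%:Z q 0 erefl.
have -> : limg (koszul_d Xf u q 0%:Z (0%:Z - 1)) = 0%VS.
  apply/eqP; rewrite -subv0; apply/subvP => x _; rewrite memv0; apply/eqP.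
  exact: koszul_lt0.
rewrite dimv0 /betti /koszul_rank => h1 h2.
have {}h2 := h2 ltac:(lia) erefl.
lia.
Qed.

End Koszul.

(** * Comparison with relative homology *)

Section RelativeHomology.
Variables (F : fieldType) (X : cellComplex F) (A B : {set X}).
Hypotheses (sA : subcomplex A) (sB : subcomplex B) (AB : A \subset B).
Implicit Types q : int.

Lemma rel_bd_bd q : (limg (rel_bd B A (q + 1) q) <= lker (rel_bd B A q (q - 1)))%VS.
Proof.
have sub C : subcomplex C -> (bd X @: chains C (q + 1) <= chains C q)%VS.
  by move=> sC; have := sC (q + 1); rewrite addrK.
apply/subvP => _ /memv_imgP[x _ ->]; rewrite memv_ker.
have := memvf x; rewrite -limg_cls => /memv_imgP[c cB ->].
rewrite quot_map_cls ?sub // quot_map_cls ?bd_bd ?linear0 //.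
exact: subvP (sub _ sB) _ (memv_img _ cB).
Qed.

(* The long exact sequence of the pair (B, A). *)
Lemma dim_rel_H q :
  (\dim {: rel_H B A q})%:Z =
   (\dim (cycles B q))%:Z - (\dim (cycles A q + boundaries B q))%:Z
   + (\dim (chains A (q - 1) :&: boundaries B (q - 1)))%:Z
   - (\dim (boundaries A (q - 1)))%:Z.
Proof.
have sub C p : subcomplex C -> (bd X @: chains C (p + 1) <= chains C p)%VS.
  by move=> sC; have := sC (p + 1); rewrite addrK.
have h0 : (\dim {: rel_H B A q} + \dim (limg (rel_bd B A (q + 1) q))
    + \dim (limg (rel_bd B A q (q - 1))) = \dim {: rel_chains B A q})%N.
  exact: dim_homology (rel_bd_bd q).
have h1 : (\dim {: rel_chains B A q} + \dim (chains A q) = \dim (chains B q))%N.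
  exact/dim_quot/chainsS.
have h2 : (\dim (limg (rel_bd B A (q + 1) q)) + \dim (chains A q)
    = \dim (bd X @: chains B (q + 1) + chains A q))%N.
  by apply: dim_limg_quot_map; apply: sub.
have h3 : (\dim (limg (rel_bd B A q (q - 1))) + \dim (chains A (q - 1))
    = \dim (bd X @: chains B q + chains A (q - 1)))%N.
  exact: dim_limg_quot_map.
have h4 := limg_ker_dim (bd X) (chains A q).
have h5 := limg_ker_dim (bd X) (chains B q).
have h6 := dimv_sum_cap (bd X @: chains B (q + 1))%VS (chains A q).
have h7 := dimv_sum_cap (bd X @: chains B q)%VS (chains A (q - 1)).
have h8 := dimv_sum_cap (cycles A q) (bd X @: chains B (q + 1))%VS.
have h9 : (cycles A q :&: bd X @: chains B (q + 1) =
           bd X @: chains B (q + 1) :&: chains A q)%VS.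
  apply/vspaceP => x; rewrite !memv_cap memv_ker andbC; apply: andb_id2l.
  by case/memv_imgP => c _ ->; rewrite bd_bd eqxx andbT.
rewrite h9 in h8.
rewrite /boundaries subrK [X in _ + (\dim X)%:Z]capvC.
rewrite /cycles in h8 *; lia.
Qed.

End RelativeHomology.

(** * The augmentation of the total complex and the two estimates *)

Section Augmentation.
Variables (F : fieldType) (X : cellComplex F) (n : nat) (hn : (1 <= n)%N).
Variables (Xf : filtration X n) (u : 'rV[int]_n).
Implicit Types (c : mv_space X n) (sigma tau : {set 'I_n}) (i : nat) (p q k : int).
Local Notation Y := (shifted F X n Xf u).
Local Notation A := (shifted_cup F X n Xf u).
Local Notation Fil := (mv_filt Xf u).
Local Notation D := (mv_D X n).
Local Notation hor := (aug_hor F X n).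
Local Notation ZZ := (cycle_column F X n Xf u).
Local Notation BB := (boundary_column F X n Xf u).
Local Notation inj0 := (mv_inj X (set0 : {set 'I_n})).
Local Notation T := (Fil (n%:Z - 1)).

Definition augmentation : 'Hom(mv_space X n, total_chains X) :=
  linfun (fun c : mv_space X n => hor c set0).
Local Notation eps := augmentation.

Lemma augmentationE c : eps c = hor c set0.
Proof.
by rewrite linfun_linearE // => a x y; rewrite linearP !ffunE.
Qed.

Lemma mv_total_aug k c : c \in T k ->
  c \in aug_mv F X n Xf u k /\ c set0 = 0.
Proof.
move=> /mem_mv_filt cT; split; last first.
  by have := cT set0; rewrite /filt_family cards0 /= memv0 => /eqP.
apply/mem_family_space => sigma; have := cT sigma.
rewrite /filt_family /aug_chains /= /mv_base card_gt0.
case: eqP => [_|_] /=; first by rewrite memv0 => /eqP->; apply: mem0v.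
by case: ifP => // _; rewrite memv0 => /eqP->; apply: mem0v.
Qed.

Lemma aug_mv_total k c : c \in aug_mv F X n Xf u k -> c - inj0 (c set0) \in T k.
Proof.
move=> /mem_family_space cG; apply/mem_mv_filt => sigma.
have -> : (c - inj0 (c set0)) sigma = c sigma - inj0 (c set0) sigma by rewrite !ffunE.
rewrite mv_injE; case: eqP => [->|/eqP s0]; first by rewrite subrr mem0v.
have := cG sigma; rewrite subr0 /filt_family /aug_chains /mv_base (negPf s0) card_gt0 s0 /=.
rewrite ifT // subrK lez_nat -[X in (_ <= X)%N]card_ord; exact: max_card.
Qed.

Lemma aug_D0 c : aug_D F X n c set0 = eps c - bd X (c set0).
Proof. by rewrite aug_DE aug_verE cards0 expr1 scaleN1r augmentationE. Qed.

Lemma eps_local c c' : (forall sigma, sigma != set0 -> c sigma = c' sigma) -> eps c = eps c'.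
Proof.
move=> cc'; rewrite !augmentationE !aug_horE; apply: eq_bigr => j _.
by rewrite cc' // set1U_neq0.
Qed.

(** This is the component at the empty set of [aug_D] applied twice: the augmentation is a chain
    map. *)
Lemma eps_D c : eps (D c) = bd X (eps c).
Proof.
have := congr1 (fun x : mv_space X n => x set0) (aug_D_D F X n c).
rewrite /= !aug_D0 linearB /= bd_bd subr0 [RHS]ffunE => /subr0_eq <-.
by apply: eps_local => sigma s0; rewrite mv_DE (negPf s0).
Qed.

Lemma eps_E c : eps c = \sum_j c [set j].
Proof.
rewrite augmentationE aug_horE; apply: eq_big => [j|j _]; first by rewrite inE.
by rewrite setU0 removal_sign1 scale1r.
Qed.

Lemma eps_cycles q : (eps @: ZZ 1 q <= cycles A q)%VS.
Proof.
apply/subvP => _ /memv_imgP[c /mem_column cZ ->]; rewrite eps_E; apply: memv_suml => j _.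
have := cZ [set j]; rewrite cards1 eqxx; apply: subvP; apply: cyclesS.
by apply: shifted_sub_cup; rewrite -card_gt0 cards1.
Qed.

Lemma eps_total k c : c \in T k -> eps c \in chains (Xf u) k.
Proof.
move=> /mem_mv_filt cT; rewrite eps_E; apply: memv_suml => j _.
have := cT [set j]; rewrite /filt_family cards1; case: ifP => [_|_]; last first.
  by rewrite memv0 => /eqP->; apply: mem0v.
rewrite addrK; apply: subvP; apply: chainsS.
apply: subset_trans (shifted_cup_sub _ _ _ _ _); apply: shifted_sub_cup.
by rewrite -card_gt0 cards1.
Qed.

(** Surjectivity of H(T) -> H(A). A cycle a of A placed in column -1 bounds some w by exactness; the
    part of w off the empty set is a cycle of T mapping to a plus a boundary of A. *)
Lemma eps_cycles_surj q : (cycles A q <= eps @: (T q :&: lker D) + boundaries A q)%VS.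
Proof.
apply/subvP => a; rewrite memv_cap memv_ker => /andP[aA /eqP da].
(* A q-chain in column -1 has total degree q - 1. *)
have gG : inj0 a \in aug_mv F X n Xf u (q - 1).
  apply/mem_family_space => sigma; rewrite mv_injE; case: eqP => [->|_]; last exact: mem0v.
  by rewrite /aug_chains /mv_base eqxx cards0 subrK subr0.
have dg : aug_D F X n (inj0 a) = 0.
  apply/ffunP => tau; rewrite aug_DE aug_horE aug_verE mv_injE [RHS]ffunE.
  rewrite big1 ?add0r => [|j _]; last by rewrite mv_injE (negPf (set1U_neq0 _ _ _)) scaler0.
  by case: eqP => _; rewrite ?da ?linear0 ?scaler0.
have [w] := aug_mv_exact F X n Xf u hn _ _ gG dg; rewrite subrK => wG dw.
have aE : a = eps w - bd X (w set0) by rewrite -aug_D0 dw mv_injE eqxx.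
pose x : mv_space X n := w - inj0 (w set0).
have xw sigma : sigma != set0 -> x sigma = w sigma.
  move=> s0; have -> : x sigma = w sigma - inj0 (w set0) sigma by rewrite !ffunE.
  by rewrite mv_injE (negPf s0) subr0.
rewrite aE -(eps_local x w xw); apply: memv_add.
  apply: memv_img; rewrite memv_cap aug_mv_total // memv_ker; apply/eqP/ffunP => tau.
  rewrite mv_DE [RHS]ffunE; case: eqP => // /eqP t0.
  by rewrite (aug_D_local _ _ _ _ w) // dw mv_injE (negPf t0).
rewrite memvN; apply: memv_img.
by move/mem_family_space/(_ set0): wG; rewrite /aug_chains /mv_base eqxx cards0 subr0.
Qed.

(** Injectivity of H(T) -> H(A). If c maps to [bd a], then c together with a in column -1 is an
    augmented cycle; a chain bounding it, restricted to nonempty sets, bounds c. *)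
Lemma eps_boundaries_inj k c : c \in T k -> D c = 0 -> eps c \in boundaries A k ->
  c \in (D @: T (k + 1))%VS.
Proof.
move=> cT dc /memv_imgP[a aA ca]; have [cG c0] := mv_total_aug _ _ cT.
pose g : mv_space X n := c + inj0 a.
have gE sigma : g sigma = if sigma == set0 then a else c sigma.
  have -> : g sigma = c sigma + inj0 a sigma by rewrite !ffunE.
  by rewrite mv_injE; case: eqP => [->|_]; rewrite ?c0 ?add0r ?addr0.
have gc sigma : sigma != set0 -> g sigma = c sigma by rewrite gE => /negPf->.
have gG : g \in aug_mv F X n Xf u k.
  rewrite memvD //; apply/mem_family_space => sigma.
  rewrite mv_injE; case: eqP => [->|_]; last exact: mem0v.
  by rewrite /aug_chains /mv_base eqxx cards0 subr0.
have dg : aug_D F X n g = 0.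
  apply/ffunP => tau; rewrite [RHS]ffunE; have [->|t0] := eqVneq tau set0.
    by rewrite aug_D0 (eps_local g c gc) gE eqxx ca subrr.
  have := congr1 (fun x : mv_space X n => x tau) dc.
  by rewrite /= mv_DE (negPf t0) [RHS]ffunE (aug_D_local _ _ _ g c).
have [w wG dw] := aug_mv_exact F X n Xf u hn _ _ gG dg.
apply/memv_imgP; exists (w - inj0 (w set0)); first exact: aug_mv_total.
apply/ffunP => tau; rewrite mv_DE; case: eqP => [->|/eqP t0]; first by rewrite c0.
rewrite (aug_D_local _ _ _ _ w) // ?dw ?gc // => sigma s0.
have -> : (w - inj0 (w set0)) sigma = w sigma - inj0 (w set0) sigma by rewrite !ffunE.
by rewrite mv_injE (negPf s0) subr0.
Qed.

Lemma column0 (W : {set 'I_n} -> {vspace total_chains X}) :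
  column F X n 0 W = (inj0 @: W set0)%VS.
Proof.
apply/eqP; rewrite eqEsubv; apply/andP; split; apply/subvP => c.
  move=> /mem_column cW; have -> : c = inj0 (c set0).
    apply/ffunP => sigma; rewrite mv_injE; have := cW sigma; rewrite cards_eq0.
    by case: eqP => [->|].
  by apply: memv_img; have := cW set0; rewrite cards0.
case/memv_imgP => x xW ->; apply/mem_column => sigma; rewrite cards_eq0 mv_injE.
by case: eqP => [->|].
Qed.

Lemma dim_limg_inj0 (W : {vspace total_chains X}) : \dim (inj0 @: W) = \dim W.
Proof.
apply: limg_dim_eq; apply/eqP; rewrite -subv0; apply/subvP => x.
rewrite memv_cap memv_ker memv0 => /andP[_ /eqP x0].
by have := congr1 (fun c : mv_space X n => c set0) x0; rewrite /= mv_injE eqxx ffunE => ->.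
Qed.

(** In degree 0 only the empty set remains, with X^u there, and the horizontal map into it is the
    augmentation. *)
Lemma koszul_rank0 q : koszul_rank F X n Xf u 0 q =
  (\dim (eps @: ZZ 1 q + boundaries (Xf u) q))%:Z - (\dim (boundaries (Xf u) q))%:Z.
Proof.
rewrite /koszul_rank /boundary_column column0 dim_limg_inj0 shifted0.
suff -> : (hor @: ZZ 1 q = inj0 @: (eps @: ZZ 1 q))%VS by rewrite -limgD dim_limg_inj0.
rewrite -limg_comp; apply: eq_in_limg => c cZ; rewrite comp_lfunE /= augmentationE.
have := subvP (hor_cycle_column F X n Xf u 0 q) _ (memv_img hor cZ).
rewrite {1}/cycle_column column0 => /memv_imgP[x _ ->].
by rewrite mv_injE eqxx.
Qed.

Lemma betti0_eps q : (betti Xf u 0%:Z q)%:Z =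
  (\dim (cycles (Xf u) q))%:Z - (\dim (eps @: ZZ 1 q + boundaries (Xf u) q))%:Z.
Proof.
rewrite betti0 koszul_rank0 /cycle_column /boundary_column !column0 !dim_limg_inj0 shifted0.
ring.
Qed.

Lemma mv_total_D k : (D @: T (k + 1) <= T k)%VS.
Proof. by have := mv_filt_D F X n Xf u (n%:Z - 1) (k + 1); rewrite addrK. Qed.

Lemma limg_D_ker (U : {vspace mv_space X n}) : (D @: U <= lker D)%VS.
Proof. by apply/subvP => _ /memv_imgP[x _ ->]; rewrite memv_ker mv_D_D. Qed.

(** The augmentation maps H_q(T) / F_0 H_q(T) onto the image of H_q(A) in H_q(X^u) modulo the image
    of the sum of the H_q(X_j), because F_0 H_q(T) is represented by families of cycles of the
    X_j. *)
Lemma cycles_cup_bound q :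
  (\dim (cycles A q + boundaries (Xf u) q) + \dim (Fil 0 q :&: lker D)
   + \dim (T q :&: D @: T (q + 1)) <=
   \dim (T q :&: lker D) + \dim (Fil 0 q :&: D @: T (q + 1))
   + \dim (eps @: ZZ 1 q + boundaries (Xf u) q))%N.
Proof.
pose U' := (Fil 0 q :&: lker D + D @: T (q + 1))%VS.
have h := codim_surj F (mv_space X n) (total_chains X) eps (T q :&: lker D)%VS U'
  (cycles A q + boundaries (Xf u) q)%VS (eps @: ZZ 1 q + boundaries (Xf u) q)%VS.
have AX := boundariesS _ _ _ _ q (shifted_cup_sub F X n Xf u).
have {h} := h _ _ _ _.
have dimU := dimv_sum_cap (Fil 0 q :&: lker D)%VS (D @: T (q + 1))%VS.
rewrite -/U' -capvA (capv_idPr (limg_D_ker _)) in dimU.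
rewrite (capv_idPr (mv_total_D q)) => h.
suff : (\dim (cycles A q + boundaries (Xf u) q) + \dim U' <=
   \dim (T q :&: lker D) + \dim (eps @: ZZ 1 q + boundaries (Xf u) q))%N by lia.
apply: h.
- rewrite subv_add capvS ?mv_filt_mono //=; last by lia.
  by rewrite subv_cap mv_total_D limg_D_ker.
- rewrite subv_add; apply/andP; split; last by rewrite addvA addvSr.
  apply: subv_trans (eps_cycles_surj q) _; apply: addvS => //.
  by apply: subv_trans AX _; apply: addvSr.
- by apply: addvS => //; apply: eps_cycles.
rewrite limgD subv_add mv_filt0_ker addvSl /=; apply: subv_trans (addvSr _ _).
apply/subvP => _ /memv_imgP[_ /memv_imgP[x xT ->] ->].
by rewrite eps_D; apply: memv_img; apply: eps_total.
Qed.

(** [U] represents the kernel of the sum of the H_k(X_j) -> H_k(X^u). Modulo the boundaries of T in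
    F_0, it injects into the kernel of H_k(A) -> H_k(X^u). *)
Lemma boundaries_cup_bound k :
  (\dim (ZZ 1 k) + \dim (boundaries (Xf u) k) + \dim (boundaries A k) <=
   \dim (eps @: ZZ 1 k + boundaries (Xf u) k)
   + \dim (chains A k :&: boundaries (Xf u) k) + \dim (Fil 0 k :&: D @: T (k + 1)))%N.
Proof.
pose U := (ZZ 1 k :&: eps @^-1: boundaries (Xf u) k)%VS.
have h1 := codim_inj F (mv_space X n) (total_chains X) eps (ZZ 1 k) U
  (eps @: ZZ 1 k + boundaries (Xf u) k)%VS (boundaries (Xf u) k)
  (addvSl _ _) (addvSr _ _) (subvv _).
suff : (\dim U + \dim (boundaries A k) <= \dim (chains A k :&: boundaries (Xf u) k)
   + \dim (Fil 0 k :&: D @: T (k + 1)))%N by lia.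
apply: (codim_inj _ _ _ eps).
- apply/subvP => _ /memv_imgP[c cU ->]; move: cU => /memv_capP[cZ].
  rewrite -memv_preim => cB; rewrite memv_cap cB andbT.
  have := subvP (eps_cycles k) _ (memv_img eps cZ).
  by rewrite memv_cap => /andP[].
- rewrite subv_cap boundariesS ?shifted_cup_sub // andbT.
  have := shifted_cup_subcomplex F X n Xf u (k + 1); by rewrite addrK.
apply/subvP => c /memv_capP[/memv_capP[cZ _]]; rewrite -memv_preim => cB.
move: cZ; rewrite -mv_filt0_ker memv_cap memv_ker => /andP[cF /eqP dc].
rewrite memv_cap cF /=.
apply: eps_boundaries_inj => //; apply: subvP cF; apply: mv_filt_mono; lia.
Qed.

Lemma morseE q : (morse Xf u q)%:Z =
   (\dim (cycles (Xf u) q))%:Z - (\dim (cycles A q + boundaries (Xf u) q))%:Z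
   + (\dim (chains A (q - 1) :&: boundaries (Xf u) (q - 1)))%:Z
   - (\dim (boundaries A (q - 1)))%:Z.
Proof.
apply: dim_rel_H; first exact: shifted_cup_subcomplex.
  exact: stage_subcomplex.
exact: shifted_cup_sub.
Qed.

End Augmentation.

(** * Assembling the inequality *)

Section MorseInequality.
Variables (F : fieldType) (X : cellComplex F) (n : nat) (hn : (1 <= n)%N).
Variables (Xf : filtration X n) (u : 'rV[int]_n).
Implicit Types (i : nat) (p q k r : int).
Local Notation Fil := (mv_filt Xf u).
Local Notation D := (mv_D X n).
Local Notation fZ := (fil_Z F (mv_space X n) D Fil).
Local Notation fB := (fil_B F (mv_space X n) D Fil).
Local Notation dE := (dimE F (mv_space X n) D Fil).
Local Notation dR := (rank_fil F (mv_space X n) D Fil).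
Local Notation T := (Fil (n%:Z - 1)).
(** A page beyond the last column n - 1, so [dimE_infty] applies; the maximum with 2 lets the
    telescope from page 2 hold for n = 1 as well. *)
Local Notation N := ((maxn 2 n)%:Z).

Lemma rank_dE r p q : (rank_d Xf u r p q)%:Z = dR r p (p + q).
Proof.
have BE p' q' : ss_B Xf u r p' q' = fB r p' (p' + q').
  rewrite /ss_B /fil_B /ss_Z /fil_Z.
  have -> : p' + r - 1 + (q' - r + 2) = p' + q' + 1 by ring.
  by have -> : p' - 1 + (q' + 1) = p' + q' by ring.
have tE : p - r + (q + r - 1) = p + q - 1 by ring.
(* The spaces occur in the type of the map, so the reindexing by total degree is done on
   variables. *)
have gen Z B Z' B' : Z = fZ r p (p + q) -> B = fB r p (p + q) ->
    Z' = fZ r (p - r) (p + q - 1) -> B' = fB r (p - r) (p + q - 1) ->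
    (\dim (limg (quot_map Z B Z' B' D)))%:Z = dR r p (p + q).
  move=> -> -> -> ->; apply: rank_quot_map_fil; [exact: mv_D_D | exact: mv_filt_mono].
by apply: gen; rewrite ?BE ?tE // /ss_Z tE.
Qed.

(** In positive columns E^1 with d^1 is the Koszul complex shifted by one degree, with both the
    incoming and the outgoing differential present. *)
Lemma dimE2_betti i k : dE 2 i.+1%:Z k = (betti Xf u (i.+1%:Z + 1) (k - i.+1%:Z))%:Z.
Proof.
have := dimE_step F (mv_space X n) D Fil 1 i.+1%:Z k; rewrite mv_dimE1.
have := mv_rank1 F X n Xf u i k.
have := mv_rank1 F X n Xf u i.+1 (k + 1).
have -> : k + 1 - i.+2%:Z = k - i.+1%:Z by lia.
have -> : i.+1%:Z + 1 = i.+2%:Z by lia.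
rewrite betti_succ /koszul_rank /=.
have -> : (1 + 1 : int) = 2 by [].
lia.
Qed.

(** Nothing leaves column 0 on the first page, whereas the Koszul complex goes on to degree 0; the
    rank of that last differential is the correction. *)
Lemma dimE2_0 k :
  dE 2 0 k = (betti Xf u 1 k)%:Z + koszul_rank F X n Xf u 0 k.
Proof.
have := dimE_step F (mv_space X n) D Fil 1 0 k.
rewrite (mv_dimE1 F X n Xf u 0) subr0 mv_rank0 //.
have := mv_rank1 F X n Xf u 0 (k + 1); rewrite /= addrK.
have := betti_succ F X n Xf u 0 k; rewrite /koszul_rank.
have -> : (1 + 1 : int) = 2 by [].
have -> : 0 + 1 = 1%:Z :> int by [].
have -> : (1%:Z) = 1 by [].
lia.
Qed.

Lemma dimE_telescope p k :
  \sum_(2 <= r < n) (dR r%:Z p k + dR r%:Z (p + r%:Z) (k + 1)) = dE 2 p k - dE N p k.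
Proof.
have [n2|n2] := leqP n 2; first by rewrite big_geq // subrr.
rewrite (eq_bigr (fun r : nat => - dE r.+1%:Z p k - - dE r%:Z p k)); last first.
  by move=> r _; rewrite -dimE_step opprK addrC intS (addrC 1).
by rewrite telescope_sumr ?(ltnW n2) // opprK addrC.
Qed.

Lemma dimE_inf i k : (i < n)%N -> dE N i%:Z k =
   (\dim (Fil i%:Z k :&: lker D))%:Z - (\dim (Fil (i%:Z - 1) k :&: lker D))%:Z
   - (\dim (Fil i%:Z k :&: D @: T (k + 1)))%:Z
   + (\dim (Fil (i%:Z - 1) k :&: D @: T (k + 1)))%:Z.
Proof.
move=> i_n; apply: dimE_infty; try lia.
- exact: mv_filt_lt0.
- exact: mv_filt_ge.
Qed.

Lemma sum_dimE_inf k : \sum_(1 <= i < n) dE N i%:Z k =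
  (\dim (T k :&: lker D))%:Z - (\dim (Fil 0 k :&: lker D))%:Z
   - (\dim (T k :&: D @: T (k + 1)))%:Z + (\dim (Fil 0 k :&: D @: T (k + 1)))%:Z.
Proof.
pose g (i : nat) : int := (\dim (Fil (i%:Z - 1) k :&: lker D))%:Z
  - (\dim (Fil (i%:Z - 1) k :&: D @: T (k + 1)))%:Z.
rewrite (eq_big_nat _ _ (F2 := fun i => g i.+1 - g i)) => [|i /andP[_ i_n]].
  by rewrite telescope_sumr // /g subrr; ring.
rewrite dimE_inf // /g; have -> : i.+1%:Z - 1 = i%:Z by lia.
ring.
Qed.

Lemma morse_lower_bound q :
  (betti Xf u 0 q)%:Z + (betti Xf u 1 (q - 1))%:Z - \sum_(1 <= i < n) dE N i%:Z q
  - \sum_(2 <= r < n) dR r%:Z r%:Z q <= (morse Xf u q)%:Z.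
Proof.
(* These are the differentials entering E^r_(0,q-1); since none leave it with positive rank, they
   account for its whole drop after page 2. *)
have -> : \sum_(2 <= r < n) dR r%:Z r%:Z q = dE 2 0 (q - 1) - dE N 0 (q - 1).
  rewrite -dimE_telescope; apply: eq_big_nat => r /andP[r2 _].
  by rewrite mv_rank0 ?add0r ?subrK //; lia.
have c1 := cycles_cup_bound F X n hn Xf u q.
have c2 := boundaries_cup_bound F X n hn Xf u (q - 1).
have e := dimE_inf 0 (q - 1) hn.
rewrite !(mv_filt_lt0 _ _ _ _ _ (0%:Z - 1)) // !cap0v dimv0 mv_filt0_ker in e.
rewrite e dimE2_0 koszul_rank0 sum_dimE_inf morseE.
have := betti0_eps F X n Xf u q; have -> : 0%:Z = 0 by [].
lia.
Qed.

End MorseInequality.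

Theorem theorem7p3 (F : fieldType) (X : cellComplex F) (n : nat) (hn : (1 <= n)%N)
    (Xf : filtration X n) (u : 'rV[int]_n) (q : nat) :
  let mu := fun q : int => (morse Xf u q)%:Z in
  let xi := fun i q : int => (betti Xf u i q)%:Z in
  let rk_d := fun r p q : int => (rank_d Xf u r p q)%:Z in
  let R : int := \sum_(2 <= r < n)
    (\sum_(1 <= i < r) rk_d r%:Z i%:Z (q%:Z - i%:Z)
     + \sum_(r.+1 <= i < n) rk_d r%:Z i%:Z (q%:Z - i%:Z)
     + \sum_(1 <= i < n) rk_d r%:Z (i%:Z + r%:Z) (q%:Z - i%:Z - r%:Z + 1)) in
  0 <= R /\
  mu q >= xi 0 q + xi 1 (q%:Z - 1)
          - \sum_(1 <= i < n) xi (i%:Z + 1) (q%:Z - i%:Z) + R.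
Proof.
move=> mu xi rk_d R; split.
  by apply: sumr_ge0 => r _; rewrite !addr_ge0 //; apply: sumr_ge0 => i _.
pose dR := rank_fil F (mv_space X n) (mv_D X n) (mv_filt Xf u).
pose dE := dimE F (mv_space X n) (mv_D X n) (mv_filt Xf u).
(* R collects the ranks leaving and entering the columns i >= 1 in total degree q, except those
   leaving column r on page r, which end in column 0; restoring them gives the full drop from page 2
   to the last page. *)
have RE : R = \sum_(1 <= i < n) (dE 2 i%:Z q%:Z - dE (maxn 2 n)%:Z i%:Z q%:Z)
              - \sum_(2 <= r < n) dR r%:Z r%:Z q%:Z.
  under eq_bigr => i _ do rewrite -dimE_telescope.
  rewrite exchange_big -sumrB; apply: eq_big_nat => r /andP[r2 rn].
  rewrite big_split [RHS]addrAC; congr (_ + _); last first.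
    by apply: eq_bigr => i _; rewrite /rk_d rank_dE; congr (rank_fil _ _ _ _ _ _ _); ring.
  have dRE a b : \sum_(a <= i < b) rk_d r%:Z i%:Z (q%:Z - i%:Z) =
      \sum_(a <= i < b) dR r%:Z i%:Z q%:Z.
    by apply: eq_bigr => i _; rewrite /rk_d rank_dE subrKC.
  rewrite !dRE.
  (* Cutting the sum at i = r isolates the term missing from R. *)
  rewrite [in RHS](big_cat_nat (n := r)) ?(ltnW r2) ?(ltnW rn) //=.
  by rewrite (big_ltn rn) -addrA [in RHS]addrAC subrr add0r.
have E2 : \sum_(1 <= i < n) dE 2 i%:Z q%:Z = \sum_(1 <= i < n) xi (i%:Z + 1) (q%:Z - i%:Z).
  by apply: eq_big_nat => -[|i] //= _; rewrite /dE dimE2_betti.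
have := morse_lower_bound F X n hn Xf u q%:Z.
rewrite RE sumrB E2 -/dE -/dR /mu /xi.
by rewrite -!addrA addKr !addrA.
Qed.
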